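(* Let $N\in\mathbb N$. For every chain complex $C$ of finite rank free $\mathbb Z^N$-persistence modules there exists a morphism $\varphi\colon \nu C[N]\to C$ in the derived category $\mathcal D(\mathbf{pers}(\mathbb Z^N))$, natural in $C$, such that: \begin{enumerate} \item if, for some $d\in\mathbb Z$, each of the modules $H_d(C),\dotsc,H_{d+N}(C)$ eventually vanishes, then \[ H_d(\varphi)\colon H_{d+N}(\nu C)\to H_d(C) \] is an isomorphism; \item if $C$ is eventually acyclic, then $\varphi$ is an isomorphism in $\mathcal D(\mathbf{pers}(\mathbb Z^N))$. \end{enumerate}
   Context: Fix a field $\mathbb F$ and $N\in\mathbb N$; $\mathbb Z^N$ carries the product partial order. A $\mathbb Z^N$-persistence module is a functor $M$ from the poset $\mathbb Z^N$ to finite-dimensional $\mathbb F$-vector spaces, with components $M_z$; morphisms are natural transformations, $\operatorname{Hom}(L,M)$ is the vector space of morphisms, and $\mathbf{pers}(\mathbb Z^N)$ is the resulting abelian category. $\mathcal D(\mathbf{pers}(\mathbb Z^N))$ is its derived category, i.e. the localization of the category of (unbounded) chain complexes at quasi-isomorphisms. The shift $M\langle z\rangle$ has components $M\langle z\rangle_w=M_{z+w}$. For $z\in\mathbb Z^N$, $F(z)$ has $F(z)_v=\mathbb F$ if $z\le v$ and $0$ otherwise, and $I(z)$ has $I(z)_v=\mathbb F$ if $v\le z$ and $0$ otherwise, with identities between nonzero components. A finite rank free module is one isomorphic to a finite direct sum of modules $F(z)$. Pointwise dual: $(M^* )_z=\operatorname{Hom}_{\mathbb F}(M_{-z},\mathbb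 F)$ with dualized structure maps. Global dual: with $\mathbf 1=(1,\dotsc,1)$, $(M^\dagger)_z=\operatorname{Hom}(M,F(\mathbf 1)\langle z\rangle)=\operatorname{Hom}(M,F(\mathbf 1-z))$ with induced structure maps. The Nakayama functor is the covariant functor $\nu M=(M^\dagger)^*$; it satisfies $\nu F(z)\cong I(z-\mathbf 1)$, and is applied degreewise to chain complexes. For a chain complex $C$, $C[N]$ is the chain complex with $C[N]_d=C_{d+N}$. A persistence module eventually vanishes if its support $\{z:M_z\ne0\}$ is bounded above; $C$ is eventually acyclic if $H_d(C)$ eventually vanishes for all $d$. *)

(* Defs.v *)
From HB Require Import structures.
From mathcomp Require Import all_boot all_order all_algebra.
From mathcomp Require Import generic_quotient ring_quotient boolp.
Set Implicit Arguments.
Unset Strict Implicit.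
Unset Printing Implicit Defensive.
Import Order.TTheory GRing.Theory Num.Theory VectorInternalTheory.
Local Open Scope ring_scope.

Section LinearMaps.
Variables (F : fieldType) (U V : lmodType F).

Lemma lin_ext (f g : {linear U -> V}) : (forall x, f x = g x) -> f = g.
Proof.
move=> fg; have {fg} : f = g :> (U -> V) by apply/funext.
case: f g => [f [[fA] [fZ]]] [g [[gA] [gZ]]] /= fg; case: g / fg in gA gZ *.
by rewrite (Prop_irrelevance fA gA) (Prop_irrelevance fZ gZ).
Qed.

HB.instance Definition _ := gen_eqMixin {linear U -> V}.
HB.instance Definition _ := gen_choiceMixin {linear U -> V}.

Definition lin_add (f g : {linear U -> V}) : {linear U -> V} := f \+ g.
Definition lin_opp (f : {linear U -> V}) : {linear U -> V} := \- f.
Definition lin_zero : {linear U -> V} := \0.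
Definition lin_scale (a : F) (f : {linear U -> V}) : {linear U -> V} := a \*: f.

Fact lin_addA : associative lin_add.
Proof. by move=> f g h; apply: lin_ext => x /=; rewrite addrA. Qed.
Fact lin_addC : commutative lin_add.
Proof. by move=> f g; apply: lin_ext => x /=; rewrite addrC. Qed.
Fact lin_add0 : left_id lin_zero lin_add.
Proof. by move=> f; apply: lin_ext => x /=; rewrite add0r. Qed.
Fact lin_addN : left_inverse lin_zero lin_opp lin_add.
Proof. by move=> f; apply: lin_ext => x /=; rewrite addNr. Qed.

HB.instance Definition _ := GRing.isZmodule.Build {linear U -> V}
  lin_addA lin_addC lin_add0 lin_addN.

Fact lin_scaleA a b (f : {linear U -> V}) :
  lin_scale a (lin_scale b f) = lin_scale (a * b) f.
Proof. by apply: lin_ext => x /=; rewrite scalerA. Qed.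
Fact lin_scale1 : left_id 1 lin_scale.
Proof. by move=> f; apply: lin_ext => x /=; rewrite scale1r. Qed.
Fact lin_scaleDr : right_distributive lin_scale +%R.
Proof. by move=> a f g; apply: lin_ext => x /=; rewrite scalerDr. Qed.
Fact lin_scaleDl (f : {linear U -> V}) : {morph lin_scale^~ f : a b / a + b}.
Proof. by move=> a b; apply: lin_ext => x /=; rewrite scalerDl. Qed.

HB.instance Definition _ := GRing.Zmodule_isLmodule.Build F {linear U -> V}
  lin_scaleA lin_scale1 lin_scaleDr lin_scaleDl.

End LinearMaps.

Definition lin_comp (F : fieldType) (U V W : lmodType F)
  (g : {linear V -> W}) (f : {linear U -> V}) : {linear U -> W} := g \o f.

Definition fin_dim (F : fieldType) (V : lmodType F) : Prop :=
  exists n, inhabited (Vector.axiom n V).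

Section FiniteDimension.
Variable F : fieldType.

Lemma vspace_of_pred (E : vectType F) (P : E -> Prop) :
    P 0 -> (forall a u v, P u -> P v -> P (a *: u + v)) ->
  exists U : {vspace E}, forall u, u \in U <-> P u.
Proof.
move=> P0 PD; pose Q m := `[< exists2 U : {vspace E},
  \dim U = m & forall u, u \in U -> P u >].
have exQ : exists m, Q m.
  exists 0%N; apply/asboolP; exists 0%VS; first exact: dimv0.
  by move=> u; rewrite memv0 => /eqP->.
have ubQ m : Q m -> (m <= \dim {:E})%N.
  by move=> /asboolP [U <- _]; apply/dimvS/subvf.
case: (ex_maxnP exQ ubQ) => m /asboolP [U dimU UP] maxm.
exists U => u; split=> [/UP //|Pu]; apply: contrapT => /negP uNU.
have /maxm : Q (\dim (U + <[u]>)%VS).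
  apply/asboolP; exists (U + <[u]>)%VS => // v /memv_addP [x /UP Px [y]].
  move=> /vlineP [a ->] ->; rewrite addrC; exact: PD.
rewrite dimv_disjoint_sum ?dimU ?dim_vline.
  by rewrite addnC; case: eqP uNU => [->|_ _]; rewrite ?mem0v // ltnn.
apply/eqP; rewrite -subv0; apply/subvP => x /memv_capP [xU /vlineP [a ax]].
move: xU; rewrite memv0 ax => xU; case: (a =P 0) => [->|/eqP a0].
  by rewrite scale0r.
by move: uNU; rewrite -[u](scalerK a0) memvZ.
Qed.

Lemma inj_surj_bijective (A B : Type) (f : A -> B) :
  injective f -> (forall y, exists x, f x = y) -> bijective f.
Proof.
move=> fI fS; exists (fun y => sval (cid (fS y))) => [x|y].
  by apply: fI; case: cid.
by case: cid.
Qed.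

Lemma fin_dim_inj_vect (V : lmodType F) (E : vectType F) (f : {linear V -> E}) :
  injective f -> fin_dim V.
Proof.
move=> fI; have [||U UP] := @vspace_of_pred E (fun u => exists x, f x = u).
- by exists 0; rewrite linear0.
- by move=> a _ _ [x <-] [y <-]; exists (a *: x + y); rewrite linearP.
exists (dim (subvs_of U)); constructor.
exists (fun x => v2r (vsproj U (f x))).
  by move=> a x y; rewrite !linearP.
have fK x : vsval (vsproj U (f x)) = f x by rewrite vsprojK //; apply/UP; exists x.
apply: inj_surj_bijective => [x y /(can_inj v2rK)|y].
  by move=> /(congr1 vsval); rewrite !fK => /fI.
have /UP [x fx] := subvsP (r2v y); exists x.
by rewrite fx vsvalK r2vK.
Qed.

Lemma fin_dim_vect (E : vectType F) : fin_dim E.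
Proof. exact: (@fin_dim_inj_vect E E idfun). Qed.

Lemma fin_dimP (V : lmodType F) : fin_dim V ->
  exists n, exists f : {linear V -> 'rV[F]_n}, exists2 g : {linear 'rV[F]_n -> V},
    cancel f g & cancel g f.
Proof.
case=> n [[f fl [g fK gK]]]; exists n.
pose fL := GRing.isLinear.Build _ _ _ _ f fl.
pose f' : {linear V -> 'rV[F]_n} := HB.pack f fL.
have gl : linear g.
  by move=> a u v; apply: (can_inj fK); rewrite fl !gK.
pose gL := GRing.isLinear.Build _ _ _ _ g gl.
pose g' : {linear 'rV[F]_n -> V} := HB.pack g gL.
by exists f', g'.
Qed.

Lemma fin_dim_inj (V W : lmodType F) (f : {linear V -> W}) :
  injective f -> fin_dim W -> fin_dim V.
Proof.
move=> fI /fin_dimP [n [h [k hK _]]].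
by apply: (@fin_dim_inj_vect V _ (lin_comp h f)) => x y /(can_inj hK) /fI.
Qed.

Lemma fin_dim_surj (V W : lmodType F) (f : {linear V -> W}) :
  (forall y, exists x, f x = y) -> fin_dim V -> fin_dim W.
Proof.
move=> fS /fin_dimP [n [h [k hK kK]]].
have [||U UP] := @vspace_of_pred 'rV[F]_n (fun u => f (k u) = 0).
- by rewrite !linear0.
- by move=> a u v fu fv; rewrite !linearP fu fv scaler0 addr0.
have sP w : exists2 u, u \in (U^C)%VS & f (k u) = w.
  have [x fx] := fS w.
  have /memv_addP [u uU [v vU uv]] : h x \in (U + U^C)%VS by rewrite addv_complf memvf.
  exists v => //; rewrite -fx -[x]hK uv !linearD.
  by have /UP -> := uU; rewrite add0r.
pose s w := s2val (cid2 (sP w)).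
have sC w : s w \in (U^C)%VS by rewrite /s; case: cid2.
have sK w : f (k (s w)) = w by rewrite /s; case: cid2.
have kI u : u \in (U^C)%VS -> f (k u) = 0 -> u = 0.
  move=> uC /UP uU; apply/eqP; rewrite -memv0 -(capv_compl U).
  by rewrite memv_cap uU uC.
have sl : linear s.
  move=> a x y; apply/eqP; rewrite -subr_eq0; apply/eqP/kI.
    by rewrite memvB ?memvD ?memvZ.
  by rewrite 2!linearB 2!linearD /= !linearZ /= !sK subrr.
pose sL := GRing.isLinear.Build _ _ _ _ s sl.
pose s' : {linear W -> 'rV[F]_n} := HB.pack s sL.
by apply: (@fin_dim_inj_vect _ _ s') => x y sxy; rewrite -[x]sK -[y]sK -[s x]/(s' x) sxy.
Qed.

Lemma fin_dim_pair (V W : lmodType F) :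
  fin_dim V -> fin_dim W -> fin_dim (V * W)%type.
Proof.
move=> /fin_dimP [m [f [f' fK _]]] /fin_dimP [n [g [g' gK _]]].
pose h (x : V * W) := (f x.1, g x.2).
have hl : linear h by move=> a x y; rewrite /h /= !linearP.
pose hL := GRing.isLinear.Build _ _ _ _ h hl.
pose h' : {linear (V * W)%type -> ('rV[F]_m * 'rV[F]_n)%type} := HB.pack h hL.
apply: (@fin_dim_inj_vect _ _ h') => -[x1 x2] [y1 y2] [] /= e1 e2.
by rewrite (can_inj fK e1) (can_inj gK e2).
Qed.

Lemma fin_dim_dual (V : lmodType F) : fin_dim V -> fin_dim {linear V -> F^o}.
Proof.
move=> /fin_dimP [n [f [g fK gK]]].
pose h (u : {linear V -> F^o}) : 'rV[F]_n := \row_i u (g (delta_mx 0 i)).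
have hl : linear h by move=> a u v; apply/rowP => i; rewrite !mxE.
pose hL := GRing.isLinear.Build _ _ _ _ h hl.
pose h' : {linear {linear V -> F^o} -> 'rV[F]_n} := HB.pack h hL.
apply: (@fin_dim_inj_vect _ _ h') => u v /rowP uv; apply: lin_ext => x.
rewrite -[x]fK [f x]row_sum_delta !linear_sum; apply: eq_bigr => i _.
by rewrite !linearZ /=; congr (_ *: _); have := uv i; rewrite !mxE.
Qed.

End FiniteDimension.

Section Quotient.
Variables (F : fieldType) (V : lmodType F) (S : {pred V}).
Hypothesis S_submod : submod_closed S.

(* The proof argument lets canonical structures find that [S] is closed. *)
Definition submod_pred of submod_closed S : V -> bool := fun x => x \in S.
HB.instance Definition _ := GRing.isZmodClosed.Build V (submod_pred S_submod)
  (GRing.submod_closedB S_submod).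

Definition submod_zmod : zmodClosed V :=
  GRing.ZmodClosed.clone V (submod_pred S_submod) _.

Definition quotient := Quotient.quot submod_zmod.
HB.instance Definition _ := GRing.Zmodule.on quotient.
Definition qpi (x : V) : quotient := \pi_(Quotient.quot submod_zmod)%qT x.
Definition qrepr (q : quotient) : V := repr (q : Quotient.quot submod_zmod).

Lemma qreprK : cancel qrepr qpi. Proof. exact: reprK. Qed.

Lemma qpiP x y : qpi x = qpi y <-> x - y \in S.
Proof.
have E : (x - y \in S) = (qpi x == qpi y) := Quotient.idealrBE submod_zmod x y.
by rewrite E; split=> [xy|/eqP //]; apply/eqP.
Qed.

Lemma qpiD x y : qpi (x + y) = qpi x + qpi y.
Proof. exact: (raddfD (\pi_(Quotient.quot submod_zmod)%qT)). Qed.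

Definition qscale (a : F) (q : quotient) : quotient := qpi (a *: qrepr q).

Lemma qscale_pi a x : qscale a (qpi x) = qpi (a *: x).
Proof. by apply/qpiP; rewrite -scalerBr; apply: GRing.subsemimod_closedZ;
  [apply: GRing.submod_closed_semi | apply/qpiP/qreprK]. Qed.

Fact qscaleA a b q : qscale a (qscale b q) = qscale (a * b) q.
Proof. by rewrite -[q]qreprK !qscale_pi scalerA. Qed.
Fact qscale1 : left_id 1 qscale.
Proof. by move=> q; rewrite -[q]qreprK qscale_pi scale1r. Qed.
Fact qscaleDr : right_distributive qscale +%R.
Proof.
by move=> a q r; rewrite -[q]qreprK -[r]qreprK -qpiD !qscale_pi scalerDr qpiD.
Qed.
Fact qscaleDl q : {morph qscale^~ q : a b / a + b}.
Proof. by move=> a b; rewrite -[q]qreprK !qscale_pi scalerDl qpiD. Qed.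

HB.instance Definition _ := GRing.Zmodule_isLmodule.Build F quotient
  qscaleA qscale1 qscaleDr qscaleDl.

Fact qpi_linear : linear qpi.
Proof. by move=> a x y; rewrite qpiD -qscale_pi. Qed.

HB.instance Definition _ := GRing.isLinear.Build F V quotient *:%R qpi qpi_linear.

End Quotient.

Section HomologySpace.
Variables (F : fieldType) (U V W : lmodType F).
Variables (f : {linear U -> V}) (g : {linear V -> W}).

Definition ker_pred : pred V := fun x => g x == 0.
Fact ker_pred_submod : submod_closed ker_pred.
Proof.
split=> [|a x y]; rewrite !unfold_in ?linear0 // => /eqP gx /eqP gy.
by rewrite linearP gx gy scaler0 addr0.
Qed.
HB.instance Definition _ :=
  GRing.isSubmodClosed.Build F V ker_pred (GRing.submod_closed_semi ker_pred_submod).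

Record cycle := Cycle { cycle_val : V; _ : ker_pred cycle_val }.
HB.instance Definition _ := [isSub for cycle_val].
HB.instance Definition _ := [Choice of cycle by <:].
HB.instance Definition _ := [SubChoice_isSubLmodule of cycle by <:].

Definition boundary : pred cycle := fun x => `[< exists y, f y = val x >].
Fact boundary_submod : submod_closed boundary.
Proof.
split=> [|a x y]; rewrite !unfold_in.
  by apply/asboolP; exists 0; rewrite linear0.
move=> /asboolP [u fu] /asboolP [v fv]; apply/asboolP.
by exists (a *: u + v); rewrite linearP fu fv linearP.
Qed.

(* ker g / (im f :&: ker g), which is ker g / im f whenever g \o f = 0. *)
Definition homology_space : lmodType F := quotient boundary_submod.

Lemma cycleP (x : cycle) : g (val x) = 0.
Proof. by case: x => x /= /eqP. Qed.

Lemma fin_dim_homology : fin_dim V -> fin_dim homology_space.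
Proof.
move=> Vfd; apply: (@fin_dim_surj _ _ _ (qpi boundary_submod)).
  by move=> q; exists (qrepr q); apply: qreprK.
exact: (@fin_dim_inj _ _ _ (val : {linear cycle -> V}) val_inj).
Qed.

End HomologySpace.

Section HomologyMap.
Variables (F : fieldType) (U V W U' V' W' : lmodType F).
Variables (f : {linear U -> V}) (g : {linear V -> W}).
Variables (f' : {linear U' -> V'}) (g' : {linear V' -> W'}).
Variable u : {linear V -> V'}.
Hypothesis u_ker : forall x, g x = 0 -> g' (u x) = 0.
Hypothesis u_im : forall y, exists y', f' y' = u (f y).

Fact cycle_map_subproof (x : cycle g) : ker_pred g' (u (val x)).
Proof. by apply/eqP/u_ker/cycleP. Qed.
Definition cycle_map (x : cycle g) : cycle g' := Cycle (cycle_map_subproof x).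

Definition homology_map_fun (q : homology_space f g) : homology_space f' g' :=
  qpi _ (cycle_map (qrepr q)).

Lemma homology_mapE x :
  homology_map_fun (qpi (boundary_submod f g) x) = qpi _ (cycle_map x).
Proof.
apply/qpiP; set y := qrepr _.
have /qpiP /asboolP [v fv] : qpi (boundary_submod f g) y = qpi _ x by apply: qreprK.
apply/asboolP; have [v' fv'] := u_im v; exists v'.
by rewrite fv' fv /= linearB.
Qed.

Fact homology_map_linear : linear homology_map_fun.
Proof.
move=> a q r; rewrite -[q]qreprK -[r]qreprK -linearP !homology_mapE -linearP.
by congr (qpi _ _); apply: val_inj; rewrite /= linearP.
Qed.
HB.instance Definition _ := GRing.isLinear.Build F
  (homology_space f g) (homology_space f' g') *:%R homology_map_fun homology_map_linear.

Definition homology_map : {linear homology_space f g -> homology_space f' g'} :=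
  homology_map_fun.

End HomologyMap.

Record category := Category {
  obj :> Type;
  hom : obj -> obj -> Type;
  idc : forall X, hom X X;
  comp : forall X Y Z, hom Y Z -> hom X Y -> hom X Z;
  comp1f : forall X Y (f : hom X Y), comp (idc Y) f = f;
  compf1 : forall X Y (f : hom X Y), comp f (idc X) = f;
  compA : forall X Y Z T (h : hom Z T) (g : hom Y Z) (f : hom X Y),
    comp h (comp g f) = comp (comp h g) f
}.

Arguments idc {c} X.

Definition is_iso (C : category) (X Y : C) (f : hom X Y) : Prop :=
  exists g : hom Y X, comp g f = idc X /\ comp f g = idc Y.

Record functor (C D : category) := Functor {
  fobj :> C -> D;
  fmap : forall X Y, hom X Y -> hom (fobj X) (fobj Y);
  fmap1 : forall X, fmap (idc X) = idc (fobj X);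
  fmapM : forall X Y Z (g : hom Y Z) (f : hom X Y),
    fmap (comp g f) = comp (fmap g) (fmap f)
}.

Arguments fmap {C D} f0 {X Y}.

Definition functor_comp (C D E : category) (G : functor D E) (H : functor C D) :
  functor C E.
Proof.
refine (@Functor C E (fun X => G (H X)) (fun X Y f => fmap G (fmap H f)) _ _).
  by move=> X; rewrite !fmap1.
by move=> X Y Z g f; rewrite !fmapM.
Defined.

Record nat_trans (C D : category) (G H : functor C D) := NatTrans {
  component :> forall X : C, hom (G X) (H X);
  naturality : forall (X Y : C) (f : hom X Y),
    comp (component Y) (fmap G f) = comp (fmap H f) (component X)
}.

Section Localization.
Variables (C : category) (W : forall X Y : C, hom X Y -> Prop).

(* Morphisms of C[W^-1]: formal composites of morphisms of C and of inverses of
   morphisms in W, modulo the congruence generated by the relations [lrel]. *)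
Inductive lterm : C -> C -> Type :=
| lgen X Y : hom X Y -> lterm X Y
| linv X Y (w : hom X Y) : W w -> lterm Y X
| lcomp X Y Z : lterm Y Z -> lterm X Y -> lterm X Z.

Inductive lrel : forall X Y, lterm X Y -> lterm X Y -> Prop :=
| lrel_refl X Y (s : lterm X Y) : lrel s s
| lrel_sym X Y (s t : lterm X Y) : lrel s t -> lrel t s
| lrel_trans X Y (s t u : lterm X Y) : lrel s t -> lrel t u -> lrel s u
| lrel_comp X Y Z (s s' : lterm Y Z) (t t' : lterm X Y) :
    lrel s s' -> lrel t t' -> lrel (lcomp s t) (lcomp s' t')
| lrel_assoc X Y Z T (s : lterm Z T) (t : lterm Y Z) (u : lterm X Y) :
    lrel (lcomp s (lcomp t u)) (lcomp (lcomp s t) u)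
| lrel_idl X Y (s : lterm X Y) : lrel (lcomp (lgen (idc Y)) s) s
| lrel_idr X Y (s : lterm X Y) : lrel (lcomp s (lgen (idc X))) s
| lrel_gen X Y Z (g : hom Y Z) (f : hom X Y) :
    lrel (lcomp (lgen g) (lgen f)) (lgen (comp g f))
| lrel_invl X Y (w : hom X Y) (Ww : W w) :
    lrel (lcomp (linv Ww) (lgen w)) (lgen (idc X))
| lrel_invr X Y (w : hom X Y) (Ww : W w) :
    lrel (lcomp (lgen w) (linv Ww)) (lgen (idc Y)).

(* An equivalence class is represented by its membership predicate. *)
Definition lhom (X Y : C) : Type :=
  {P : lterm X Y -> Prop | exists t, P = lrel t}.

Lemma lhom_ext X Y (p q : lhom X Y) : sval p = sval q -> p = q.
Proof.
by case: p q => [P hP] [Q hQ] /= e; case: Q / e in hQ *; rewrite (Prop_irrelevance hP hQ).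
Qed.

Definition lclass X Y (t : lterm X Y) : lhom X Y := exist _ (lrel t) (ex_intro _ t erefl).
Definition lrepr X Y (p : lhom X Y) : lterm X Y := sval (cid (svalP p)).

Lemma lclassP X Y (s t : lterm X Y) : lclass s = lclass t <-> lrel s t.
Proof.
split=> [[e]|st]; first by rewrite e; apply: lrel_refl.
apply: lhom_ext; apply/funext => u; apply/propext; split=> [su|tu].
  by apply: lrel_trans su; apply: lrel_sym.
exact: lrel_trans tu.
Qed.

Lemma lreprK X Y (p : lhom X Y) : lclass (lrepr p) = p.
Proof.
by apply: lhom_ext => /=; rewrite /lrepr; case: cid => t /= ->.
Qed.

Lemma lrepr_class X Y (t : lterm X Y) : lrel (lrepr (lclass t)) t.
Proof. by apply/lclassP/lreprK. Qed.

Definition lhom_comp X Y Z (q : lhom Y Z) (p : lhom X Y) : lhom X Z :=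
  lclass (lcomp (lrepr q) (lrepr p)).

Lemma lhom_compE X Y Z (t : lterm Y Z) (s : lterm X Y) :
  lhom_comp (lclass t) (lclass s) = lclass (lcomp t s).
Proof. by apply/lclassP; apply: lrel_comp; apply: lrepr_class. Qed.

Definition localization : category.
Proof.
refine (@Category C lhom (fun X => lclass (lgen (idc X))) lhom_comp _ _ _).
- by move=> X Y f; rewrite -[f]lreprK lhom_compE; apply/lclassP/lrel_idl.
- by move=> X Y f; rewrite -[f]lreprK lhom_compE; apply/lclassP/lrel_idr.
move=> X Y Z T h g f; rewrite -[f]lreprK -[g]lreprK -[h]lreprK !lhom_compE.
exact/lclassP/lrel_assoc.
Defined.

Definition loc_functor : functor C localization.
Proof.
refine (@Functor C localization id (fun X Y f => lclass (lgen f)) _ _) => //.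
by move=> X Y Z g f; rewrite /= lhom_compE; apply/esym/lclassP/lrel_gen.
Defined.

Lemma loc_functor_iso X Y (w : hom X Y) : W w -> is_iso (fmap loc_functor w).
Proof.
move=> Ww; exists (lclass (linv Ww)).
by split; rewrite /= lhom_compE; apply/lclassP; [apply: lrel_invl|apply: lrel_invr].
Qed.

Section Induced.
Variables (D : category) (G : functor C D).
Hypothesis GW : forall X Y (w : hom X Y), W w -> is_iso (fmap G w).

Fixpoint leval X Y (t : lterm X Y) : hom (G X) (G Y) :=
  match t with
  | lgen _ _ f => fmap G f
  | linv _ _ _ Ww => sval (cid (GW Ww))
  | lcomp _ _ _ s t => comp (leval s) (leval t)
  end.

Lemma leval_eq X Y (s t : lterm X Y) : lrel s t -> leval s = leval t.
Proof.
elim=> {X Y s t} //=.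
- by move=> X Y s t u _ -> _ ->.
- by move=> X Y Z s s' t t' _ -> _ ->.
- by move=> *; rewrite compA.
- by move=> *; rewrite fmap1 comp1f.
- by move=> *; rewrite fmap1 compf1.
- by move=> *; rewrite fmapM.
- by move=> X Y w Ww; rewrite fmap1; case: cid => g [].
- by move=> X Y w Ww; rewrite fmap1; case: cid => g [].
Qed.

Definition loc_induced : functor localization D.
Proof.
refine (@Functor localization D G (fun X Y p => leval (lrepr p)) _ _).
  by move=> X; rewrite -fmap1; apply/(leval_eq (lrepr_class _)).
by move=> X Y Z g f; apply: (leval_eq (lrepr_class _)).
Defined.

Lemma loc_inducedE X Y (f : hom X Y) : fmap loc_induced (fmap loc_functor f) = fmap G f.
Proof. exact: (leval_eq (lrepr_class _)). Qed.

End Induced.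
End Localization.

Definition grade (N : nat) : zmodType := {ffun 'I_N -> int}.
Definition grade_le N (z w : grade N) : bool := [forall i, z i <= w i].
Notation "z <=g w" := (grade_le z w) (at level 70).

Section GradeOrder.
Variable N : nat.
Implicit Types z w u : grade N.

Lemma grade_le_refl z : z <=g z.
Proof. by apply/forallP. Qed.
Lemma grade_le_trans z w u : z <=g w -> w <=g u -> z <=g u.
Proof.
by move=> /forallP zw /forallP wu; apply/forallP => i; apply: le_trans (wu i).
Qed.
Lemma grade_le_opp z w : z <=g w -> - w <=g - z.
Proof. by move=> /forallP zw; apply/forallP => i; rewrite !ffunE lerN2. Qed.
Lemma grade_le_add z w u : z <=g w -> z + u <=g w + u.
Proof. by move=> /forallP zw; apply/forallP => i; rewrite !ffunE lerD2r. Qed.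
Lemma grade_le_addl z w u : z <=g w -> u + z <=g u + w.
Proof. by rewrite ![u + _]addrC; apply: grade_le_add. Qed.
End GradeOrder.

Definition grade_one N : grade N := [ffun=> 1].

(* Functors from the poset Z^N to all vector spaces: the global dual of a
   pointwise finite-dimensional module need not be pointwise finite-dimensional. *)
Record vmod (F : fieldType) (N : nat) := VMod {
  vobj :> grade N -> lmodType F;
  vmap : forall z w, z <=g w -> {linear vobj z -> vobj w};
  vmap_id : forall z (zz : z <=g z) x, vmap zz x = x;
  vmap_comp : forall z w u (zw : z <=g w) (wu : w <=g u) (zu : z <=g u) x,
    vmap wu (vmap zw x) = vmap zu x
}.
Arguments vmap {F N} v {z w}.

Record vhom (F : fieldType) (N : nat) (L M : vmod F N) := VHom {
  vcomponent :> forall z, {linear L z -> M z};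
  vnatural : forall z w (zw : z <=g w) x,
    vcomponent w (vmap L zw x) = vmap M zw (vcomponent z x)
}.

Section HomSpace.
Variables (F : fieldType) (N : nat) (L M : vmod F N).

Lemma vhom_ext (f g : vhom L M) : (forall z x, f z x = g z x) -> f = g.
Proof.
move=> fg; have {fg} : vcomponent f = vcomponent g.
  by apply: functional_extensionality_dep => z; apply: lin_ext.
case: f g => [f hf] [g hg] /= e; case: g / e in hg *.
by rewrite (Prop_irrelevance hf hg).
Qed.

HB.instance Definition _ := gen_eqMixin (vhom L M).
HB.instance Definition _ := gen_choiceMixin (vhom L M).

Fact vhom_add_subproof (f g : vhom L M) z w (zw : z <=g w) x :
  (f w + g w) (vmap L zw x) = vmap M zw ((f z + g z) x).
Proof. by rewrite /= !vnatural linearD. Qed.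
Definition vhom_add (f g : vhom L M) : vhom L M := VHom (vhom_add_subproof f g).

Fact vhom_opp_subproof (f : vhom L M) z w (zw : z <=g w) x :
  (- f w) (vmap L zw x) = vmap M zw ((- f z) x).
Proof. by rewrite /= !vnatural linearN. Qed.
Definition vhom_opp (f : vhom L M) : vhom L M := VHom (vhom_opp_subproof f).

Fact vhom_zero_subproof z w (zw : z <=g w) x :
  (0 : {linear L w -> M w}) (vmap L zw x) = vmap M zw ((0 : {linear L z -> M z}) x).
Proof. by rewrite /= linear0. Qed.
Definition vhom_zero : vhom L M := VHom vhom_zero_subproof.

Fact vhom_scale_subproof a (f : vhom L M) z w (zw : z <=g w) x :
  (a *: f w) (vmap L zw x) = vmap M zw ((a *: f z) x).
Proof. by rewrite /= !vnatural linearZ. Qed.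
Definition vhom_scale a (f : vhom L M) : vhom L M := VHom (vhom_scale_subproof a f).

Fact vhom_addA : associative vhom_add.
Proof. by move=> f g h; apply: vhom_ext => z x /=; rewrite addrA. Qed.
Fact vhom_addC : commutative vhom_add.
Proof. by move=> f g; apply: vhom_ext => z x /=; rewrite addrC. Qed.
Fact vhom_add0 : left_id vhom_zero vhom_add.
Proof. by move=> f; apply: vhom_ext => z x /=; rewrite add0r. Qed.
Fact vhom_addN : left_inverse vhom_zero vhom_opp vhom_add.
Proof. by move=> f; apply: vhom_ext => z x /=; rewrite addNr. Qed.

HB.instance Definition _ := GRing.isZmodule.Build (vhom L M)
  vhom_addA vhom_addC vhom_add0 vhom_addN.

Fact vhom_scaleA a b f : vhom_scale a (vhom_scale b f) = vhom_scale (a * b) f.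
Proof. by apply: vhom_ext => z x /=; rewrite scalerA. Qed.
Fact vhom_scale1 : left_id 1 vhom_scale.
Proof. by move=> f; apply: vhom_ext => z x /=; rewrite scale1r. Qed.
Fact vhom_scaleDr : right_distributive vhom_scale +%R.
Proof. by move=> a f g; apply: vhom_ext => z x /=; rewrite scalerDr. Qed.
Fact vhom_scaleDl f : {morph vhom_scale^~ f : a b / a + b}.
Proof. by move=> a b; apply: vhom_ext => z x /=; rewrite scalerDl. Qed.

HB.instance Definition _ := GRing.Zmodule_isLmodule.Build F (vhom L M)
  vhom_scaleA vhom_scale1 vhom_scaleDr vhom_scaleDl.

End HomSpace.

Section Modules.
Variables (F : fieldType) (N : nat).
Implicit Types (K L M : vmod F N) (z w u v : grade N).

Definition vhom_id M : vhom M M :=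
  @VHom F N M M (fun z => idfun) (fun z w zw x => erefl).

Fact vhom_comp_subproof K L M (g : vhom L M) (f : vhom K L) z w (zw : z <=g w) x :
  lin_comp (g w) (f w) (vmap K zw x) = vmap M zw (lin_comp (g z) (f z) x).
Proof. by rewrite /= !vnatural. Qed.
Definition vhom_comp K L M (g : vhom L M) (f : vhom K L) : vhom K M :=
  VHom (vhom_comp_subproof g f).

Definition vmod_cat : category.
Proof.
refine (@Category (vmod F N) (@vhom F N) vhom_id vhom_comp _ _ _);
  by move=> *; apply: vhom_ext.
Defined.

Definition vshift M z : vmod F N.
Proof.
refine (@VMod F N (fun w => M (z + w))
  (fun w u wu => vmap M (grade_le_addl z wu)) _ _).
  by move=> w ww x; apply: vmap_id.
by move=> w u v wu uv wv x; apply: vmap_comp.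
Defined.

Definition vshift_map M z w (zw : z <=g w) : vhom (vshift M z) (vshift M w).
Proof.
refine (@VHom F N (vshift M z) (vshift M w)
  (fun u => vmap M (grade_le_add u zw)) _).
move=> u v uv x /=.
have zwuv : z + u <=g w + v.
  exact: grade_le_trans (grade_le_add u zw) (grade_le_addl w uv).
by rewrite !(vmap_comp _ _ zwuv).
Defined.

Definition indic (b : bool) : lmodType F :=
  if b then (F^o : lmodType F) else ('rV[F]_0 : lmodType F).
Definition indic_fun (b c : bool) : indic b -> indic c :=
  match b, c return indic b -> indic c with
  | true, true => fun x => x
  | _, _ => fun=> 0
  end.
Fact indic_fun_linear b c : linear (@indic_fun b c).
Proof. by case: b c => [] [] a x y /=; rewrite ?scaler0 ?addr0. Qed.
HB.instance Definition _ b c := GRing.isLinear.Build F (indic b) (indic c) *:%R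
  (@indic_fun b c) (@indic_fun_linear b c).

Lemma indic0 (x : indic false) : x = 0.
Proof. by apply/rowP => -[]. Qed.

Definition free1 z : vmod F N.
Proof.
refine (@VMod F N (fun v => indic (z <=g v))
  (fun v w vw => @indic_fun (z <=g v) (z <=g w)) _ _).
  by move=> w _ /=; case: (z <=g w) => x //=; rewrite [x]indic0.
move=> v w u vw wu vu /=.
have := @grade_le_trans N z v w; have := @grade_le_trans N z w u.
case: (z <=g v) => [_ /(_ isT vw) ->|_ _ x]; last by rewrite [x]indic0 !linear0.
by [].
Defined.

Definition zero_vmod : vmod F N :=
  @VMod F N (fun=> indic false) (fun _ _ _ => idfun) (fun _ _ _ => erefl)
    (fun _ _ _ _ _ _ _ => erefl).

Section DirectSum.
Variables L M : vmod F N.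
Definition dsum_fun z w (zw : z <=g w) (x : (L z * M z)%type) : (L w * M w)%type :=
  (vmap L zw x.1, vmap M zw x.2).
Fact dsum_fun_linear z w (zw : z <=g w) : linear (dsum_fun zw).
Proof. by move=> a x y; rewrite /dsum_fun /= !linearP. Qed.
HB.instance Definition _ z w (zw : z <=g w) := GRing.isLinear.Build F
  (L z * M z)%type (L w * M w)%type *:%R (dsum_fun zw) (dsum_fun_linear zw).
Definition dsum : vmod F N.
Proof.
refine (@VMod F N (fun z => (L z * M z)%type : lmodType F)
  (fun z w zw => dsum_fun zw) _ _).
  by move=> z zz [x y]; rewrite /= /dsum_fun /= !vmap_id.
by move=> z w u zw wu zu [x y]; rewrite /= /dsum_fun /= !(vmap_comp _ _ zu).
Defined.

Definition pair_inl (U V : lmodType F) (x : U) : (U * V)%type := (x, 0).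
Fact pair_inl_linear U V : linear (@pair_inl U V).
Proof. by move=> a x y; congr pair; rewrite /= scaler0 addr0. Qed.
HB.instance Definition _ (U V : lmodType F) := GRing.isLinear.Build F
  U (U * V)%type *:%R (@pair_inl U V) (@pair_inl_linear U V).

Definition pair_inr (U V : lmodType F) (x : V) : (U * V)%type := (0, x).
Fact pair_inr_linear U V : linear (@pair_inr U V).
Proof. by move=> a x y; congr pair; rewrite /= scaler0 addr0. Qed.
HB.instance Definition _ (U V : lmodType F) := GRing.isLinear.Build F
  V (U * V)%type *:%R (@pair_inr U V) (@pair_inr_linear U V).

Definition dsum_inl : vhom L dsum.
Proof.
refine (@VHom F N L dsum (fun z => @pair_inl (L z) (M z)) _).
by move=> z w zw x; congr pair; rewrite /= linear0.
Defined.
Definition dsum_inr : vhom M dsum.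
Proof.
refine (@VHom F N M dsum (fun z => @pair_inr (L z) (M z)) _).
by move=> z w zw x; congr pair; rewrite /= linear0.
Defined.
End DirectSum.

Definition free_sum (s : seq (grade N)) : vmod F N :=
  foldr (fun z M => dsum (free1 z) M) zero_vmod s.

Definition free_finite_rank M : Prop :=
  exists (s : seq (grade N)) (f : @hom vmod_cat M (free_sum s)), is_iso f.

Definition precomp (U V W : lmodType F) (f : {linear U -> V}) (g : {linear V -> W}) :
  {linear U -> W} := lin_comp g f.
Fact precomp_linear U V W f : linear (@precomp U V W f).
Proof. by move=> a g h; apply: lin_ext. Qed.
HB.instance Definition _ (U V W : lmodType F) (f : {linear U -> V}) := GRing.isLinear.Build F
  {linear V -> W} {linear U -> W} *:%R (@precomp U V W f) (@precomp_linear U V W f).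

Definition vprecomp K L M (f : vhom K L) (g : vhom L M) : vhom K M := vhom_comp g f.
Fact vprecomp_linear K L M f : linear (@vprecomp K L M f).
Proof. by move=> a g h; apply: vhom_ext. Qed.
HB.instance Definition _ K L M (f : vhom K L) := GRing.isLinear.Build F
  (vhom L M) (vhom K M) *:%R (@vprecomp K L M f) (@vprecomp_linear K L M f).

Definition vpostcomp K L M (g : vhom L M) (f : vhom K L) : vhom K M := vhom_comp g f.
Fact vpostcomp_linear K L M g : linear (@vpostcomp K L M g).
Proof. by move=> a f h; apply: vhom_ext => z x /=; rewrite linearP. Qed.
HB.instance Definition _ K L M (g : vhom L M) := GRing.isLinear.Build F
  (vhom K L) (vhom K M) *:%R (@vpostcomp K L M g) (@vpostcomp_linear K L M g).

Definition pdual M : vmod F N.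
Proof.
refine (@VMod F N (fun z => {linear M (- z) -> F^o} : lmodType F)
  (fun z w zw => @precomp _ _ _ (vmap M (grade_le_opp zw))) _ _).
  by move=> z zz f; apply: lin_ext => x /=; rewrite vmap_id.
by move=> z w u zw wu zu f; apply: lin_ext => x /=; rewrite (vmap_comp _ _ (grade_le_opp zu)).
Defined.

Definition pdual_map L M (f : vhom L M) : vhom (pdual M) (pdual L).
Proof.
refine (@VHom F N (pdual M) (pdual L) (fun z => @precomp _ _ _ (f (- z))) _).
by move=> z w zw g; apply: lin_ext => x /=; rewrite vnatural.
Defined.

Definition gdual M : vmod F N.
Proof.
refine (@VMod F N (fun z => vhom M (vshift (free1 (grade_one N)) z) : lmodType F)
  (fun z w zw => @vpostcomp M _ _ (vshift_map _ zw)) _ _).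
  by move=> z zz f; apply: vhom_ext => v x; 
  exact: (@vmap_id F N (free1 (grade_one N)) (z + v) (grade_le_add v zz) (f v x)).
move=> z w u zw wu zu f; apply: vhom_ext => v x.
exact: (@vmap_comp F N (free1 (grade_one N)) _ _ _ (grade_le_add v zw)
  (grade_le_add v wu) (grade_le_add v zu) (f v x)).
Defined.

Definition gdual_map L M (f : vhom L M) : vhom (gdual M) (gdual L).
Proof.
refine (@VHom F N (gdual M) (gdual L) (fun z => @vprecomp _ _ _ f) _).
by move=> z w zw g; apply: vhom_ext.
Defined.

Definition nakayama M : vmod F N := pdual (gdual M).
Definition nakayama_map L M (f : vhom L M) : vhom (nakayama L) (nakayama M) :=
  pdual_map (gdual_map f).

Lemma nakayama_map_id M : nakayama_map (vhom_id M) = vhom_id (nakayama M).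
Proof.
apply: vhom_ext => z x; apply: lin_ext => g /=; congr (x _).
by apply: vhom_ext.
Qed.

Lemma nakayama_map_comp K L M (g : vhom L M) (f : vhom K L) :
  nakayama_map (vhom_comp g f) = vhom_comp (nakayama_map g) (nakayama_map f).
Proof.
apply: vhom_ext => z x; apply: lin_ext => h /=; congr (x _).
by apply: vhom_ext.
Qed.

Lemma nakayama_map0 L M : nakayama_map (0 : vhom L M) = 0.
Proof.
apply: vhom_ext => z x; apply: lin_ext => h /=; rewrite -[RHS](linear0 x).
by congr (x _); apply: vhom_ext => v y /=; rewrite linear0.
Qed.

Definition pointwise_fin_dim M : Prop := forall z, fin_dim (M z).

Lemma fin_dim_indic b : fin_dim (indic b).
Proof. by case: b; [apply: (fin_dim_vect F^o)|apply: (fin_dim_vect 'rV[F]_0)]. Qed.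

Definition indic1 b : indic b := @indic_fun true b (1 : F).

Lemma indic1_span b (x : indic b) : exists a : F, x = a *: indic1 b.
Proof.
case: b x => x; last by exists 0; rewrite scale0r [x]indic0.
by exists x; rewrite /= /GRing.scale /= mulr1.
Qed.

Lemma vmap_indic1 z w (zw : z <=g w) : vmap (free1 z) zw (indic1 (z <=g z)) = indic1 (z <=g w).
Proof. by rewrite /= zw; move: (grade_le_refl z); case: (z <=g z). Qed.

Section FreeHom.
Variable M : vmod F N.
Hypothesis Mfd : pointwise_fin_dim M.

Lemma fin_dim_hom_free1 z : fin_dim (vhom (free1 z) M).
Proof.
pose e (f : vhom (free1 z) M) : M z := f z (indic1 (z <=g z)).
have el : linear e by [].
pose eL := GRing.isLinear.Build _ _ _ _ e el.
pose e' : {linear vhom (free1 z) M -> M z} := HB.pack e eL.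
apply: (@fin_dim_inj _ _ _ e') => // f g fg; apply: vhom_ext => w x.
have [a ->] := indic1_span x; rewrite !linearZ; congr (_ *: _).
have [zw|/negP/negPf zw] := pselect (z <=g w).
  by rewrite -(vmap_indic1 zw) !vnatural; congr (vmap _ _ _).
have z0 : forall y : indic (z <=g w), y = 0 by rewrite zw; apply: indic0.
by rewrite (z0 (indic1 _)); rewrite !linear0.
Qed.

Lemma fin_dim_hom_free_sum s : fin_dim (vhom (free_sum s) M).
Proof.
elim: s => [|z s IHs].
  apply: (@fin_dim_inj _ _ {linear indic false -> F^o} 0).
    by move=> f g _; apply: vhom_ext => w x; rewrite [x]indic0 !linear0.
  exact/fin_dim_dual/fin_dim_indic.
pose e (f : vhom (free_sum (z :: s)) M) : (vhom (free1 z) M * vhom (free_sum s) M)%type :=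
  (vhom_comp f (dsum_inl _ _), vhom_comp f (dsum_inr _ _)).
have el : linear e by move=> a f g; congr pair; apply: vhom_ext.
pose eL := GRing.isLinear.Build _ _ _ _ e el.
pose e' : {linear vhom (free_sum (z :: s)) M -> (vhom (free1 z) M * vhom (free_sum s) M)%type}
  := HB.pack e eL.
apply: (@fin_dim_inj _ _ _ e'); last exact/fin_dim_pair/IHs/fin_dim_hom_free1.
move=> f g fg; apply: vhom_ext => w [x y].
have -> : (x, y) = (x, 0) + (0, y) :> (free_sum (z :: s) w) by congr pair; rewrite /= ?addr0 ?add0r.
rewrite !linearD; congr (_ + _).
  exact: (congr1 (fun h : vhom (free1 z) M => h w x) (congr1 fst fg)).
exact: (congr1 (fun h : vhom (free_sum s) M => h w y) (congr1 snd fg)).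
Qed.

Lemma fin_dim_hom_free L : free_finite_rank L -> fin_dim (vhom L M).
Proof.
move=> [s [f [g [gf fg]]]].
apply: (@fin_dim_inj _ _ _ (@vprecomp _ _ M g)); last exact: (fin_dim_hom_free_sum s).
move=> h k hk; apply: vhom_ext => w x.
have gfx : g w (f w x) = x := congr1 (fun e : vhom L L => e w x) gf.
rewrite -gfx.
exact: (congr1 (fun e : vhom (free_sum s) M => e w (f w x)) hk).
Qed.
End FreeHom.

Lemma nakayama_fin_dim M : free_finite_rank M -> pointwise_fin_dim (nakayama M).
Proof.
move=> freeM z; apply: fin_dim_dual; apply: fin_dim_hom_free freeM => w.
exact: fin_dim_indic.
Qed.

Lemma free_fin_dim M : free_finite_rank M -> pointwise_fin_dim M.
Proof.
move=> [s [f [g [gf _]]]] z.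
apply: (@fin_dim_inj _ _ _ (f z)).
  apply: can_inj (g z) _ => x.
  exact: (congr1 (fun h : vhom M M => h z x) gf).
elim: {f g gf} s => [|w s IHs]; first exact: fin_dim_indic.
apply: fin_dim_pair => //; exact: fin_dim_indic.
Qed.

End Modules.

Record persmod (F : fieldType) (N : nat) := PersMod {
  persmod_vmod :> vmod F N;
  persmod_fin_dim : pointwise_fin_dim persmod_vmod
}.

Definition pers (F : fieldType) (N : nat) : category.
Proof.
refine (@Category (persmod F N) (fun L M => vhom L M)
  (fun M => vhom_id M) (fun K L M => @vhom_comp F N K L M) _ _ _);
  by move=> *; apply: vhom_ext.
Defined.

Definition eventually_vanishes (F : fieldType) (N : nat) (M : vmod F N) : Prop :=
  exists b : grade N, forall z, (exists x : M z, x <> 0) -> z <=g b.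

(* The differential lowers the degree by one; carrying the degree equation as an
   argument avoids transports when degrees are shifted. *)
Record complex (F : fieldType) (N : nat) := Complex {
  ch_obj :> int -> persmod F N;
  ch_diff : forall i j, i = j + 1 -> vhom (ch_obj i) (ch_obj j);
  ch_diff2 : forall i j k (ij : i = j + 1) (jk : j = k + 1),
    vhom_comp (ch_diff jk) (ch_diff ij) = 0
}.
Arguments ch_diff {F N} c {i j}.

Record chain_map (F : fieldType) (N : nat) (C D : complex F N) := ChainMap {
  cm_component :> forall i, vhom (C i) (D i);
  cm_comm : forall i j (ij : i = j + 1),
    vhom_comp (cm_component j) (ch_diff C ij) = vhom_comp (ch_diff D ij) (cm_component i)
}.

Section Complexes.
Variables (F : fieldType) (N : nat).
Implicit Types B C D : complex F N.

Lemma chain_map_ext C D (f g : chain_map C D) :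
  (forall i z x, f i z x = g i z x) -> f = g.
Proof.
move=> fg; have {fg} : cm_component f = cm_component g.
  by apply: functional_extensionality_dep => i; apply: vhom_ext.
case: f g => [f hf] [g hg] /= e; case: g / e in hg *.
by rewrite (Prop_irrelevance hf hg).
Qed.

Lemma cm_commE C D (f : chain_map C D) i j (ij : i = j + 1) z x :
  f j z (ch_diff C ij z x) = ch_diff D ij z (f i z x).
Proof. exact: (congr1 (fun h : vhom (C i) (D j) => h z x) (cm_comm f ij)). Qed.

Lemma ch_diff2E C i j k (ij : i = j + 1) (jk : j = k + 1) z x :
  ch_diff C jk z (ch_diff C ij z x) = 0.
Proof. exact: (congr1 (fun h : vhom (C i) (C k) => h z x) (ch_diff2 C ij jk)). Qed.

Definition chain_map_id C : chain_map C C.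
Proof. by refine (@ChainMap F N C C (fun i => vhom_id (C i)) _) => *; apply: vhom_ext. Defined.

Definition chain_map_comp B C D (g : chain_map C D) (f : chain_map B C) : chain_map B D.
Proof.
refine (@ChainMap F N B D (fun i => vhom_comp (g i) (f i)) _) => i j ij.
by apply: vhom_ext => z x; rewrite /= !cm_commE.
Defined.

Definition chain_cat : category.
Proof.
refine (@Category (complex F N) (@chain_map F N) chain_map_id chain_map_comp _ _ _);
  by move=> *; apply: chain_map_ext.
Defined.

Fact shift_degree (n : nat) (i j : int) : i = j + 1 -> i + n%:Z = j + n%:Z + 1.
Proof. by move=> ->; rewrite addrAC. Qed.

(* The sign (-1)^n is the usual convention for C[n]; rescaling degree i by
   (-1)^(n i) is a natural isomorphism with the unsigned variant.  Signs do not
   affect kernels and images, so H_d(C[n]) is H_(d+n)(C). *)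
Definition shift (n : nat) C : complex F N.
Proof.
refine (@Complex F N (fun i => C (i + n%:Z))
  (fun i j ij => (-1) ^+ n *: ch_diff C (shift_degree n ij)) _).
move=> i j k ij jk; apply: vhom_ext => z x.
by rewrite /= linearZ /= ch_diff2E !scaler0.
Defined.

Definition shift_map (n : nat) C D (f : chain_map C D) : chain_map (shift n C) (shift n D).
Proof.
refine (@ChainMap F N (shift n C) (shift n D) (fun i => f (i + n%:Z)) _) => i j ij.
by apply: vhom_ext => z x; rewrite /= linearZ /= cm_commE.
Defined.

Definition shift_functor (n : nat) : functor chain_cat chain_cat.
Proof.
by refine (@Functor chain_cat chain_cat (shift n) (@shift_map n) _ _) => *;
  apply: chain_map_ext.
Defined.

Section Homology.
Variable d : int.

Fact pred_degree : d = d - 1 + 1. Proof. by rewrite subrK. Qed.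

Definition diff_in C : vhom (C (d + 1)) (C d) := ch_diff C erefl.
Definition diff_out C : vhom (C d) (C (d - 1)) := ch_diff C pred_degree.

Fact vmap_ker C z w (zw : z <=g w) x :
  diff_out C z x = 0 -> diff_out C w (vmap (C d) zw x) = 0.
Proof. by move=> dx; rewrite vnatural dx linear0. Qed.
Fact vmap_im C z w (zw : z <=g w) y :
  exists y', diff_in C w y' = vmap (C d) zw (diff_in C z y).
Proof. by exists (vmap (C (d + 1)) zw y); rewrite vnatural. Qed.

Definition homology_vmod C : vmod F N.
Proof.
refine (@VMod F N (fun z => homology_space (diff_in C z) (diff_out C z))
  (fun z w zw => homology_map (@vmap_ker C z w zw) (@vmap_im C z w zw)) _ _).
  move=> z zz q; rewrite -[q]qreprK /= (homology_mapE _ (vmap_im zz)).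
  by congr (qpi _ _); apply: val_inj; rewrite /= vmap_id.
move=> z w u zw wu zu q; rewrite -[q]qreprK /= (homology_mapE _ (vmap_im zw)) (homology_mapE _ (vmap_im wu)).
rewrite (homology_mapE _ (vmap_im zu)); congr (qpi _ _).
by apply: val_inj; rewrite /= (vmap_comp _ _ zu).
Defined.

Definition homology C : persmod F N :=
  @PersMod F N (homology_vmod C)
    (fun z => fin_dim_homology _ _ (persmod_fin_dim (C d) z)).

Fact chain_map_ker C D (f : chain_map C D) z x :
  diff_out C z x = 0 -> diff_out D z (f d z x) = 0.
Proof. by move=> dx; rewrite -cm_commE dx linear0. Qed.
Fact chain_map_im C D (f : chain_map C D) z y :
  exists y', diff_in D z y' = f d z (diff_in C z y).
Proof. by exists (f (d + 1) z y); rewrite -cm_commE. Qed.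

Definition homology_chain_map C D (f : chain_map C D) : vhom (homology C) (homology D).
Proof.
refine (@VHom F N (homology C) (homology D)
  (fun z => homology_map (@chain_map_ker C D f z) (@chain_map_im C D f z)) _).
move=> z w zw q; rewrite -[q]qreprK /= (homology_mapE _ (vmap_im zw)) (homology_mapE _ (chain_map_im f (z := w))).
rewrite (homology_mapE _ (chain_map_im f (z := z))) (homology_mapE _ (vmap_im zw)).
by congr (qpi _ _); apply: val_inj; rewrite /= vnatural.
Defined.

Definition homology_functor : functor chain_cat (pers F N).
Proof.
refine (@Functor chain_cat (pers F N) homology homology_chain_map _ _).
  move=> C; apply: vhom_ext => z q; rewrite -[q]qreprK /= (homology_mapE _ (chain_map_im (chain_map_id C) (z := z))).
  by congr (qpi _ _); apply: val_inj.
move=> B C D g f; apply: vhom_ext => z q; rewrite -[q]qreprK /=.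
rewrite (homology_mapE _ (chain_map_im f (z := z))) (homology_mapE _ (chain_map_im g (z := z))).
rewrite (homology_mapE _ (chain_map_im (chain_map_comp g f) (z := z))).
by congr (qpi _ _); apply: val_inj.
Defined.

End Homology.

Definition eventually_acyclic C : Prop :=
  forall d, eventually_vanishes (homology d C).

Definition quasi_iso (C D : chain_cat) (f : hom C D) : Prop :=
  forall d, is_iso (fmap (homology_functor d) f).

Definition derived_cat : category := localization quasi_iso.
Definition to_derived : functor chain_cat derived_cat := loc_functor quasi_iso.
Definition derived_homology (d : int) : functor derived_cat (pers F N) :=
  @loc_induced chain_cat quasi_iso (pers F N) (homology_functor d)
    (fun C D f fq => fq d).

Record free_complex := FreeComplex {
  free_complex_complex :> complex F N;
  free_complex_free : forall i, free_finite_rank (free_complex_complex i)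
}.

Definition free_cat : category.
Proof.
refine (@Category free_complex (fun X Y => chain_map X Y)
  (fun X => chain_map_id X) (fun X Y Z => @chain_map_comp X Y Z) _ _ _);
  by move=> *; apply: chain_map_ext.
Defined.

Definition free_inclusion : functor free_cat chain_cat.
Proof.
by refine (@Functor free_cat chain_cat free_complex_complex (fun X Y f => f) _ _).
Defined.

Definition nakayama_complex (C : free_complex) : complex F N.
Proof.
refine (@Complex F N
  (fun i => PersMod (nakayama_fin_dim (free_complex_free C i)))
  (fun i j ij => nakayama_map (ch_diff C ij)) _).
by move=> i j k ij jk; rewrite -nakayama_map_comp ch_diff2 nakayama_map0.
Defined.

Definition nakayama_chain_map (C D : free_complex) (f : chain_map C D) :
  chain_map (nakayama_complex C) (nakayama_complex D).
Proof.
refine (@ChainMap F N (nakayama_complex C) (nakayama_complex D)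
  (fun i => nakayama_map (f i)) _) => i j ij.
by rewrite /= -!nakayama_map_comp cm_comm.
Defined.

Definition nakayama_functor : functor free_cat chain_cat.
Proof.
refine (@Functor free_cat chain_cat nakayama_complex nakayama_chain_map _ _).
  move=> C; apply: chain_map_ext => i z x.
  have e := nakayama_map_id (C i : persmod F N).
  exact: (congr1 (fun h : vhom (nakayama (C i)) (nakayama (C i)) => h z x) e).
move=> B C D g f; apply: chain_map_ext => i z x.
have e := nakayama_map_comp (g i : vhom (C i) (D i)) (f i : vhom (B i) (C i)).
exact: (congr1 (fun h : vhom (nakayama (B i)) (nakayama (D i)) => h z x) e).
Defined.

End Complexes.

(* Main.v *)
Require Import Defs.
From HB Require Import structures.
From mathcomp Require Import all_boot all_order all_algebra.
From mathcomp Require Import boolp.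
(* Imported again so that [hom] denotes morphisms in a category, not linear maps. *)
Import Defs.
Set Implicit Arguments.
Unset Strict Implicit.
Unset Printing Implicit Defensive.
Import Order.TTheory GRing.Theory Num.Theory.
Local Open Scope ring_scope.

(** Write [1] for [grade_one N].  For a free module [M] of finite rank and any module
    [Y], the morphisms from the global dual of [M] to the shifts of [Y] form a module
    [tensor Y M], which is functorial in both arguments and exact in [Y], because the
    dual of [M] is free again.  Two choices of [Y] are familiar.  If [Y] is supported on
    the grades with all coordinates at least [1], it is [free1 1], and [tensor Y M] is
    the global bidual of [M], hence [M] itself ([bidual_bij]).  If [Y] is supported on
    the grades with all coordinates at most [0], it is injective, and [tensor Y M] is
    the pointwise dual of the global dual, that is the Nakayama transform of [M]
    ([nakayama_tensor_bij]).

    The passage from the first to the second changes one coordinate at a time.  Let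
    [slab_mod k] be the module supported on the grades whose first [k] coordinates are
    at most [0] and whose other coordinates are at least [1], and let [strip_mod k] be
    defined by the same conditions except the one on coordinate [k] (counted from
    zero).  There are short exact sequences
    [0 -> slab_mod k -> strip_mod k -> slab_mod k.+1 -> 0], so tensoring with a free
    complex [C] yields natural short exact sequences of complexes of pointwise
    finite-dimensional modules.  Each has a connecting morphism in the derived
    category, from the complex of [slab_mod k.+1] shifted by one to that of
    [slab_mod k] ([connecting_morphism]); the composite of the [N] connecting morphisms
    leads from the Nakayama complex shifted by [N] to [C].

    A connecting morphism is invertible on homology where the middle complex has no
    homology.  Now [tensor (strip_mod k) M] is the colimit of [tensor (slab_mod k) M]
    along the axis [k], so its homology in a degree vanishes as soon as each homology
    class of the slab in that degree dies when moved along this axis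
    ([strip_acyclic]).  For the first slab this follows from eventual vanishing, and
    the condition passes to the next slab, one degree higher, by a diagram chase
    ([slabS_torsion]).  Counting degrees, the [N] steps on [H_d] use the homology of [C]
    exactly in the degrees [d], ..., [d + N].

    The derived category is only ever entered through roofs whose two legs are explicit
    chain maps ([derived_roof]).  Therefore, for eventually acyclic [C], each connecting
    morphism is visibly a composite of quasi-isomorphisms and their inverses. *)

(** * Roofs in the derived category *)

Lemma is_iso_id (C : category) (X : C) : is_iso (idc X).
Proof. by exists (idc X); rewrite comp1f. Qed.

Lemma is_iso_comp (C : category) (X Y Z : C) (g : hom Y Z) (f : hom X Y) :
  is_iso g -> is_iso f -> is_iso (comp g f).
Proof.
move=> [g' [g'g gg']] [f' [f'f ff']]; exists (comp f' g'); split.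
  by rewrite -compA [comp g' _]compA g'g comp1f.
by rewrite -compA [comp f _]compA ff' comp1f.
Qed.

Lemma is_iso_cancel_right (C : category) (X Y Z : C) (g : hom Y Z) (f : hom X Y) :
  is_iso f -> is_iso (comp g f) -> is_iso g.
Proof.
move=> [f' [f'f ff']] gf_iso.
rewrite -[g]compf1 -ff' compA; apply: is_iso_comp => //.
by exists f.
Qed.

Definition nat_trans_id (C D : category) (G : functor C D) : nat_trans G G.
Proof.
by refine (@NatTrans C D G G (fun X => idc (G X)) _) => X Y f; rewrite comp1f compf1.
Defined.

Definition nat_trans_comp (C D : category) (G H K : functor C D)
  (b : nat_trans H K) (a : nat_trans G H) : nat_trans G K.
Proof.
refine (@NatTrans C D G K (fun X => comp (b X) (a X)) _) => X Y f.
by rewrite -compA naturality compA naturality compA.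
Defined.

(** The component [b c] after the inverse of [a c] is natural because [a] and [b] are:
    the inverses of [a c] and [a c'] may be moved across the square of [a]. *)
Lemma roof_nat_trans (D C K : category) (Q : functor C K) (E X Y : functor D C)
    (a : nat_trans E X) (b : nat_trans E Y) :
    (forall c, is_iso (fmap Q (a c))) ->
  exists phi : nat_trans (functor_comp Q X) (functor_comp Q Y),
    forall c, comp (phi c) (fmap Q (a c)) = fmap Q (b c).
Proof.
move=> a_iso; pose inv c := sval (cid (a_iso c)).
have inva c : comp (inv c) (fmap Q (a c)) = idc _ by rewrite /inv; case: cid => ? [].
have ainv c : comp (fmap Q (a c)) (inv c) = idc _ by rewrite /inv; case: cid => ? [].
have phi_nat c c' (f : hom c c') :
    comp (comp (fmap Q (b c')) (inv c')) (fmap (functor_comp Q X) f) =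
    comp (fmap (functor_comp Q Y) f) (comp (fmap Q (b c)) (inv c)).
  rewrite -[LHS]compf1 -(ainv c) /= compA -[comp _ (fmap Q (a c))]compA.
  rewrite -fmapM -naturality fmapM compA -[comp _ (fmap Q (a c'))]compA inva compf1.
  by rewrite -fmapM naturality fmapM -compA.
pose phi c : hom (functor_comp Q X c) (functor_comp Q Y c) := comp (fmap Q (b c)) (inv c).
by exists (@NatTrans _ _ _ _ phi phi_nat) => c; rewrite /= /phi -compA inva compf1.
Qed.

Section DerivedRoof.
Variables (F : fieldType) (N : nat).

Lemma derived_homology_to_derived d (A B : chain_cat F N) (u : hom A B) :
  fmap (derived_homology F N d) (fmap (to_derived F N) u) = fmap (homology_functor F N d) u.
Proof. exact: loc_inducedE. Qed.

(** The morphism obtained by inverting [a].  It inherits from [b] the property of being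
    invertible, in a single homology degree as well as in the derived category itself.
    The latter is recorded separately, since it is immediate for a roof, whereas
    detecting it on homology in general would need a calculus of fractions. *)
Lemma derived_roof (D : category) (E X Y : functor D (chain_cat F N))
    (a : nat_trans E X) (b : nat_trans E Y) :
    (forall c, quasi_iso (a c)) ->
  exists phi : nat_trans (functor_comp (to_derived F N) X) (functor_comp (to_derived F N) Y),
    forall c,
      (forall d, is_iso (fmap (homology_functor F N d) (b c)) ->
         is_iso (fmap (derived_homology F N d) (phi c))) /\
      (quasi_iso (b c) -> is_iso (phi c)).
Proof.
move=> aq; have [|phi phia] := @roof_nat_trans _ _ _ (to_derived F N) E X Y a b.
  by move=> c; apply: loc_functor_iso; apply: aq.
exists phi => c; split=> [d bd|bq].
  apply: (@is_iso_cancel_right _ _ _ _ _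
    (fmap (derived_homology F N d) (fmap (to_derived F N) (a c)))).
    by rewrite derived_homology_to_derived; apply: aq.
  by rewrite -fmapM phia derived_homology_to_derived.
apply: (@is_iso_cancel_right _ _ _ _ _ (fmap (to_derived F N) (a c))).
  by apply: loc_functor_iso; apply: aq.
by rewrite phia; apply: loc_functor_iso.
Qed.

End DerivedRoof.

(** * Homology by elements *)

Lemma linear_inverse (F : fieldType) (U V : lmodType F) (f : {linear U -> V}) :
  bijective f -> exists2 g : {linear V -> U}, cancel f g & cancel g f.
Proof.
move=> [g fK gK]; have gl : linear g.
  by move=> a u v; apply: (can_inj fK); rewrite linearP !gK.
pose gL := GRing.isLinear.Build _ _ _ _ g gl.
by exists (HB.pack g gL : {linear V -> U}).
Qed.

Lemma vhom_is_iso (F : fieldType) (N : nat) (L M : pers F N) (f : vhom L M) :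
  (forall z, bijective (f z)) -> is_iso (f : hom L M).
Proof.
move=> f_bij; have gP z := cid2 (linear_inverse (f_bij z)).
pose g z := s2val (gP z).
have fK z : cancel (f z) (g z) := s2valP (gP z).
have gK z : cancel (g z) (f z) := s2valP' (gP z).
have g_nat z w (zw : z <=g w) x : g w (vmap M zw x) = vmap L zw (g z x).
  by apply: (can_inj (fK w)); rewrite vnatural !gK.
by exists (VHom g_nat); split; apply: vhom_ext => z x /=; rewrite ?fK ?gK.
Qed.

Section CyclesAndBoundaries.
Variables (F : fieldType) (N : nat).
Implicit Types C D : complex F N.

(** Quantifying over the neighbouring degree, instead of writing [d - 1] or [d + 1],
    makes these notions of [shift m C] in degree [d] those of [C] in degree [d + m]
    without transporting elements along equations between degrees. *)
Definition is_cycle C d z (x : C d z) : Prop :=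
  forall j (e : d = j + 1), ch_diff C e z x = 0.
Definition is_boundary C d z (x : C d z) : Prop :=
  exists i (e : i = d + 1) (y : C i z), ch_diff C e z y = x.

Lemma is_cycleP C d j (e : d = j + 1) z (x : C d z) :
  is_cycle x <-> ch_diff C e z x = 0.
Proof.
split=> [|dx j' e']; first exact.
have jj' : j' = j by apply: (@addIr _ 1); rewrite -e -e'.
by subst j'; rewrite (Prop_irrelevance e' e).
Qed.

Lemma is_boundaryP C d i (e : i = d + 1) z (x : C d z) :
  is_boundary x <-> exists y : C i z, ch_diff C e z y = x.
Proof.
split=> [[i' [e' [y <-]]]|[y dy]]; last by exists i, e, y.
have ii' : i = i' by rewrite e e'.
case: i' / ii' e' y => e' y; exists y.
by rewrite (Prop_irrelevance e' e).
Qed.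

Lemma is_cycleB C d z (x y : C d z) : is_cycle x -> is_cycle y -> is_cycle (x - y).
Proof. by move=> dx dy j e; rewrite linearB dx dy subr0. Qed.

Lemma vmap_cycle C d z w (zw : z <=g w) (x : C d z) :
  is_cycle x -> is_cycle (vmap (C d) zw x).
Proof. by move=> dx j e; rewrite vnatural dx linear0. Qed.

Lemma chain_map_boundary C D (u : chain_map C D) d z (x : C d z) :
  is_boundary x -> is_boundary (u d z x).
Proof. by move=> [i [e [y <-]]]; exists i, e, (u i z y); rewrite cm_commE. Qed.

Lemma sign_scaler_eq0 (V : lmodType F) m (x : V) : (-1) ^+ m *: x = 0 -> x = 0.
Proof. by move/eqP; rewrite scaler_eq0 signr_eq0 => /eqP. Qed.

Lemma shift_cycle C m d z (x : C (d + m%:Z) z) :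
  @is_cycle (shift m C) d z x <-> is_cycle x.
Proof.
rewrite (is_cycleP (C := shift m C) (pred_degree d)).
rewrite (is_cycleP (shift_degree m (pred_degree d))) /=.
by split=> [/sign_scaler_eq0|->]; rewrite ?scaler0.
Qed.

Lemma shift_boundary C m d z (x : C (d + m%:Z) z) :
  @is_boundary (shift m C) d z x <-> is_boundary x.
Proof.
rewrite (is_boundaryP (C := shift m C) (erefl (d + 1))).
rewrite (is_boundaryP (shift_degree m (erefl (d + 1)))).
split=> [[y <-]|[y <-]]; exists ((-1) ^+ m *: y); rewrite /= linearZ //=.
by rewrite scalerA -expr2 sqrr_sign scale1r.
Qed.

Lemma homology_isoP d C D (u : chain_map C D) :
    (forall z (x : C d z), is_cycle x -> is_boundary (u d z x) -> is_boundary x) ->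
    (forall z (y : D d z), is_cycle y ->
       exists2 x : C d z, is_cycle x & is_boundary (u d z x - y)) ->
  is_iso (fmap (homology_functor F N d) (u : @hom (chain_cat F N) C D)).
Proof.
move=> uI uS; set h : vhom (homology d C) (homology d D) :=
  fmap (homology_functor F N d) (u : @hom (chain_cat F N) C D).
have hE z x : h z (qpi (boundary_submod (diff_in d C z) (diff_out d C z)) x) =
    qpi _ (cycle_map (@chain_map_ker _ _ _ _ _ u z) x).
  exact: (homology_mapE _ (@chain_map_im _ _ d _ _ u z)).
have h_bij z : bijective (h z).
  apply: inj_surj_bijective => [q r|q].
    rewrite -[q]qreprK -[r]qreprK !hE => /qpiP /asboolP qr; apply/qpiP/asboolP.
    apply/(is_boundaryP (erefl (d + 1))); apply: uI.
      by apply: is_cycleB; apply/(is_cycleP (pred_degree d)); apply: cycleP.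
    by apply/(is_boundaryP (erefl (d + 1))); rewrite linearB.
  have [|x xc xb] := uS z (val (qrepr q)).
    by apply/(is_cycleP (pred_degree d)); apply: cycleP.
  have xk : ker_pred (diff_out d C z) x by apply/eqP; apply: xc.
  exists (qpi _ (Cycle xk)); rewrite hE -[RHS]qreprK; apply/qpiP/asboolP.
  exact/(is_boundaryP (erefl (d + 1))).
exact: vhom_is_iso.
Qed.

Lemma bijective_quasi_iso C D (u : chain_map C D) :
  (forall d z, bijective (u d z)) -> quasi_iso (u : @hom (chain_cat F N) C D).
Proof.
move=> u_bij d; apply: homology_isoP => z.
  move=> x xc [i [e [y yx]]]; have [v vK Kv] := u_bij i z.
  exists i, e, (v y); have [v' v'K _] := u_bij d z; apply: (can_inj v'K).
  by rewrite cm_commE Kv yx.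
move=> y yc; have [v vK Kv] := u_bij d z; exists (v y).
  move=> j e; have [v' v'K _] := u_bij j z; apply: (can_inj v'K).
  by rewrite cm_commE Kv yc linear0.
rewrite Kv subrr; exists (d + 1), erefl, 0; exact: linear0.
Qed.

End CyclesAndBoundaries.

(** * The connecting morphism of a short exact sequence of complexes *)

Section Pairing.
Variables (F : fieldType) (U V W : lmodType F).
Variables (f : {linear U -> V}) (g : {linear U -> W}).
Definition lin_pair (x : U) : (V * W)%type := (f x, g x).
Fact lin_pair_linear : linear lin_pair.
Proof. by move=> a x y; rewrite /lin_pair !linearP. Qed.
HB.instance Definition _ := GRing.isLinear.Build F U (V * W)%type *:%R
  lin_pair lin_pair_linear.
End Pairing.

Section Fibre.
Variables (F : fieldType) (N : nat).
Implicit Types A B Q : complex F N.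

Definition vhom_pair (K L M : vmod F N) (f : vhom K L) (g : vhom K M) : vhom K (dsum L M).
Proof.
refine (@VHom F N K (dsum L M) (fun z => lin_pair (f z) (g z)) _).
by move=> z w zw x; rewrite /= /lin_pair /dsum_fun /= !vnatural.
Defined.

Definition dsum_fst (L M : vmod F N) : vhom (dsum L M) L.
Proof. by refine (@VHom F N (dsum L M) L (fun z => fst) _). Defined.

Definition dsum_snd (L M : vmod F N) : vhom (dsum L M) M.
Proof. by refine (@VHom F N (dsum L M) M (fun z => snd) _). Defined.

(** The component of a chain map between equal degrees: the fibre below meets the
    degrees [i + m] and [j + m.+1] with [i = j + 1], which are not convertible. *)
Definition cm_at A B (f : chain_map A B) i j (e : i = j) : vhom (A i) (B j) :=
  match e in _ = j return vhom (A i) (B j) with erefl => f i end.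

Lemma cm_at_comm A B (f : chain_map A B) i j k (e : i = j) (ik : i = k + 1) l
    (jl : j = l + 1) (kl : k = l) z x :
  ch_diff B jl z (cm_at f e z x) = cm_at f kl z (ch_diff A ik z x).
Proof.
case: j / e jl => jl; case: l / kl jl => jl /=.
by rewrite cm_commE (Prop_irrelevance jl ik).
Qed.

Lemma cm_at_natural A B A' B' (f : chain_map A B) (f' : chain_map A' B')
    (a : chain_map A A') (b : chain_map B B') i j (e : i = j) z x :
    (forall k z x, b k z (f k z x) = f' k z (a k z x)) ->
  b j z (cm_at f e z x) = cm_at f' e z (a i z x).
Proof. by case: j / e. Qed.

Fact fibre_degree m (i j : int) : i = j + 1 -> i + m%:Z = j + m.+1%:Z.
Proof. by move=> ->; rewrite -addrA -PoszD. Qed.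

Definition fibre_diff A B (f : chain_map A B) m i j (e : i = j + 1) :
    vhom (dsum (B (i + m.+1%:Z)) (A (i + m%:Z))) (dsum (B (j + m.+1%:Z)) (A (j + m%:Z))) :=
  vhom_pair
    (vhom_comp (ch_diff (shift m.+1 B) e) (dsum_fst _ _) +
     vhom_comp (cm_at f (fibre_degree m e)) (dsum_snd _ _))
    (vhom_comp (ch_diff (shift m A) e) (dsum_snd _ _)).

Lemma fibre_diffE A B (f : chain_map A B) m i j (e : i = j + 1) z
    (b : B (i + m.+1%:Z) z) (a : A (i + m%:Z) z) :
  fibre_diff f m e z (b, a) =
  (ch_diff (shift m.+1 B) e z b + cm_at f (fibre_degree m e) z a, ch_diff (shift m A) e z a).
Proof. by []. Qed.

(** The shifts [m + 1] and [m] carry opposite signs, which is what makes the square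
    of [fibre_diff] vanish. *)
Lemma fibre_anticomm A B (f : chain_map A B) m i j l (ij : i = j + 1) (jl : j = l + 1) z
    (a : A (i + m%:Z) z) :
  ch_diff (shift m.+1 B) jl z (cm_at f (fibre_degree m ij) z a) =
  - cm_at f (fibre_degree m jl) z (ch_diff (shift m A) ij z a).
Proof.
rewrite /= (cm_at_comm _ _ (shift_degree m ij) _ (fibre_degree m jl)).
by rewrite linearZ /= exprS mulN1r scaleNr.
Qed.

(** The homotopy fibre of [f], shifted by [m].  It maps to the cokernel of [f] shifted
    by [m + 1] and to [A] shifted by [m], and is the apex of the roof that represents
    the connecting morphism.  Building the shift in saves the comparison of
    [shift 1 (shift m Q)] with [shift m.+1 Q]. *)
Definition fibre A B (f : chain_map A B) (m : nat) : complex F N.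
Proof.
refine (@Complex F N
  (fun i => @PersMod F N (dsum (B (i + m.+1%:Z)) (A (i + m%:Z)))
     (fun z => fin_dim_pair (persmod_fin_dim (B (i + m.+1%:Z)) z)
                            (persmod_fin_dim (A (i + m%:Z)) z)))
  (fun i j e => fibre_diff f m e) _).
move=> i j k ij jk; apply: vhom_ext => z [b a].
have ddA := ch_diff2E (C := shift m A) ij jk a.
have ddB := ch_diff2E (C := shift m.+1 B) ij jk b.
have fd := fibre_anticomm f ij jk a.
change (fibre_diff f m jk z (fibre_diff f m ij z (b, a)) = (0, 0)).
by rewrite !fibre_diffE linearD [X in (X + _ + _, _)]ddB fd add0r addNr ddA.
Defined.

Definition fibre_fst A B Q (f : chain_map A B) (q : chain_map B Q)
  (qf : forall i z x, q i z (f i z x) = 0) m : chain_map (fibre f m) (shift m.+1 Q).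
Proof.
refine (@ChainMap F N (fibre f m) (shift m.+1 Q)
  (fun i => vhom_comp (q (i + m.+1%:Z)) (dsum_fst _ _)) _) => i j e.
apply: vhom_ext => z [b a] /=.
rewrite linearD linearZ /= cm_commE.
suff -> : q (j + m.+1%:Z) z (cm_at f (fibre_degree m e) z a) = 0 by rewrite addr0.
by case: _ / (fibre_degree m e); apply: qf.
Defined.

Definition fibre_snd A B (f : chain_map A B) m : chain_map (fibre f m) (shift m A).
Proof.
refine (@ChainMap F N (fibre f m) (shift m A) (fun i => dsum_snd _ _) _) => i j e.
exact: vhom_ext.
Defined.

Definition fibre_map A B A' B' (f : chain_map A B) (f' : chain_map A' B')
  (a : chain_map A A') (b : chain_map B B')
  (ab : forall i z x, b i z (f i z x) = f' i z (a i z x)) m :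
  chain_map (fibre f m) (fibre f' m).
Proof.
refine (@ChainMap F N (fibre f m) (fibre f' m)
  (fun i => vhom_pair (vhom_comp (b (i + m.+1%:Z)) (dsum_fst _ _))
                      (vhom_comp (a (i + m%:Z)) (dsum_snd _ _))) _) => i j e.
apply: vhom_ext => z [y x]; congr pair; rewrite /= ?linearD !linearZ /= !cm_commE //.
by congr (_ + _); apply: cm_at_natural.
Defined.

Section Exact.
Variables (A B Q : complex F N) (f : chain_map A B) (q : chain_map B Q).
Hypothesis f_inj : forall i z, injective (f i z).
Hypothesis qf : forall i z x, q i z (f i z x) = 0.
Hypothesis q_ker : forall i z y, q i z y = 0 -> exists x, f i z x = y.
Hypothesis q_surj : forall i z y, exists x, q i z x = y.

Lemma cm_at_exact i j (e : i = j) z (b : B j z) :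
  q j z b = 0 -> exists a, cm_at f e z a = b.
Proof. by case: j / e b => b /q_ker. Qed.

Lemma cm_at_inj i j (e : i = j) z : injective (cm_at f e z).
Proof. by case: j / e; apply: f_inj. Qed.

(** A cycle of the fibre is an element [b] of [B] together with an [a] in [A] such that
    [f a] is the boundary of [- b]; as [f] is a kernel of [q], to give [a] is to say
    that [q b] is a cycle. *)
Lemma fibre_fst_quasi_iso m :
  quasi_iso (fibre_fst qf m : @hom (chain_cat F N) (fibre f m) (shift m.+1 Q)).
Proof.
move=> d; apply: homology_isoP => z.
  move=> [b a] bac [i [e [y' yb]]]; have [b' b'y] := q_surj y'.
  have [] : fibre_diff f m (pred_degree d) z (b, a) = (0, 0) by apply: bac.
  set db := ch_diff (shift m.+1 B) (pred_degree d) z b => dba da.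
  have [|a' a'b] := @cm_at_exact _ _ (fibre_degree m e) z (b - ch_diff (shift m.+1 B) e z b').
    rewrite linearB /= linearZ /= cm_commE b'y; apply/eqP; rewrite subr_eq0; exact/eqP.
  exists i, e, (b', a'); rewrite [LHS]fibre_diffE a'b; congr pair; first exact: subrKC.
  apply: (@cm_at_inj _ _ (fibre_degree m (pred_degree d)) z).
  rewrite -[LHS]opprK -fibre_anticomm a'b linearB.
  rewrite (ch_diff2E (C := shift m.+1 B)) subr0.
  by apply/eqP; rewrite eqr_oppLR -addr_eq0; apply/eqP.
move=> y yc; have [b qb] := q_surj y.
pose e := pred_degree d.
have [|a fa] := @cm_at_exact _ _ (fibre_degree m e) z (- ch_diff (shift m.+1 B) e z b).
  rewrite linearN /= linearZ /= cm_commE qb.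
  by have := yc _ e; rewrite /= => ->; rewrite oppr0.
exists (b, a); last by rewrite /= qb subrr; exists (d + 1), erefl, 0; apply: linear0.
apply/(is_cycleP (C := fibre f m) e); congr pair; first by rewrite /= fa addrN.
have e' := pred_degree (d - 1); apply: (@cm_at_inj _ _ (fibre_degree m e') z).
rewrite /= -[LHS]opprK -fibre_anticomm fa !linearN (ch_diff2E (C := shift m.+1 B)).
by rewrite linear0 !oppr0 linear0.
Qed.

End Exact.

Definition acyclic_at B d : Prop := forall z (x : B d z), is_cycle x -> is_boundary x.

(** In the long exact sequence of the fibre, the two neighbours of this map on homology
    are the homology of [B] in the degrees [d + m] and [d + m + 1]. *)
Lemma fibre_snd_iso A B (f : chain_map A B) m d :
    acyclic_at B (d + m%:Z) -> acyclic_at B (d + m.+1%:Z) ->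
  is_iso (fmap (homology_functor F N d)
    (fibre_snd f m : @hom (chain_cat F N) (fibre f m) (shift m A))).
Proof.
move=> B0 B1; pose e := pred_degree d.
apply: homology_isoP => z.
  move=> [b a] bac [i [e' [a' a'a]]].
  have [dba _] : fibre_diff f m e z (b, a) = (0, 0) by apply: bac.
  have /B1/shift_boundary/(is_boundaryP (C := shift m.+1 B) e') [b' b'b] :
      is_cycle (b - cm_at f (fibre_degree m e') z a').
    apply/(shift_cycle (C := B))/(is_cycleP (C := shift m.+1 B) e).
    by rewrite linearB fibre_anticomm a'a opprK.
  exists i, e', (b', a'); rewrite [LHS]fibre_diffE b'b a'a; congr pair; exact: subrK.
(* The acyclicity of [B] in degree [d + m] is used in the shape [(d - 1) + m.+1], the
   degree in which [f a] lies as an element of the fibre. *)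
move=> a ac; rewrite (fibre_degree m e) in B0.
have /B0/shift_boundary/(is_boundaryP (C := shift m.+1 B) e) [b fa] :
    is_cycle (cm_at f (fibre_degree m e) z a).
  apply/(shift_cycle (C := B))/(is_cycleP (C := shift m.+1 B) (pred_degree (d - 1))).
  by rewrite fibre_anticomm ac linear0 oppr0.
exists (- b, a); last by rewrite /= subrr; exists (d + 1), erefl, 0; apply: linear0.
apply/(is_cycleP (C := fibre f m) e); rewrite [LHS]fibre_diffE linearN fa addNr.
by congr pair; apply: ac.
Qed.

End Fibre.

Section ConnectingMorphism.
Variables (F : fieldType) (N : nat) (D : category).
Variables (FA FB FQ : functor D (chain_cat F N)).
Variables (f : nat_trans FA FB) (q : nat_trans FB FQ) (m : nat).

Let fc (c : D) : chain_map (FA c) (FB c) := f c.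
Let qc (c : D) : chain_map (FB c) (FQ c) := q c.

Lemma nat_trans_comm (G H : functor D (chain_cat F N)) (t : nat_trans G H)
    (c c' : D) (u : hom c c') i z x :
  (t c' : chain_map _ _) i z ((fmap G u : chain_map _ _) i z x) =
  (fmap H u : chain_map _ _) i z ((t c : chain_map _ _) i z x).
Proof.
exact: (congr1 (fun h : chain_map (G c) (H c') => h i z x) (naturality t u)).
Qed.

Definition fibre_functor : functor D (chain_cat F N).
Proof.
refine (@Functor D (chain_cat F N) (fun c => fibre (fc c) m)
  (fun c c' u => @fibre_map F N (FA c) (FB c) (FA c') (FB c') (fc c) (fc c')
     (fmap FA u) (fmap FB u) (fun i z x => esym (nat_trans_comm f u x)) m) _ _).
  move=> c; apply: chain_map_ext => i z [b a]; congr pair.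
    exact: (congr1 (fun h : chain_map (FB c) (FB c) => h _ z b) (fmap1 FB c)).
  exact: (congr1 (fun h : chain_map (FA c) (FA c) => h _ z a) (fmap1 FA c)).
move=> c c' c'' v u; apply: chain_map_ext => i z [b a]; congr pair.
  exact: (congr1 (fun h : chain_map (FB c) (FB c'') => h _ z b) (fmapM FB v u)).
exact: (congr1 (fun h : chain_map (FA c) (FA c'') => h _ z a) (fmapM FA v u)).
Defined.

(** The roof through the fibre of [f]: its leg to the cokernel is a quasi-isomorphism,
    and its leg to [FA] is as good as [FB] is acyclic. *)
Lemma connecting_morphism :
    (forall c i z, injective (fc c i z)) ->
    (forall c i z x, qc c i z (fc c i z x) = 0) ->
    (forall c i z y, qc c i z y = 0 -> exists x, fc c i z x = y) ->
    (forall c i z y, exists x, qc c i z x = y) ->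
  exists delta : nat_trans
      (functor_comp (to_derived F N) (functor_comp (shift_functor F N m.+1) FQ))
      (functor_comp (to_derived F N) (functor_comp (shift_functor F N m) FA)),
    forall c,
      (forall d, acyclic_at (FB c) (d + m%:Z) -> acyclic_at (FB c) (d + m.+1%:Z) ->
         is_iso (fmap (derived_homology F N d) (delta c))) /\
      ((forall d, acyclic_at (FB c) d) -> is_iso (delta c)).
Proof.
move=> f_inj qf q_ker q_surj.
have a_nat c c' (u : hom c c') :
    comp (fibre_fst (qf c') m : @hom (chain_cat F N) (fibre_functor c') (shift m.+1 (FQ c')))
      (fmap fibre_functor u) =
    comp (fmap (functor_comp (shift_functor F N m.+1) FQ) u) (fibre_fst (qf c) m).
  apply: chain_map_ext => i z [b a]; exact: (nat_trans_comm q u b).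
have b_nat c c' (u : hom c c') :
    comp (fibre_snd (fc c') m : @hom (chain_cat F N) (fibre_functor c') (shift m (FA c')))
      (fmap fibre_functor u) =
    comp (fmap (functor_comp (shift_functor F N m) FA) u) (fibre_snd (fc c) m).
  exact: chain_map_ext.
have [|delta deltaP] := @derived_roof F N D fibre_functor
  (functor_comp (shift_functor F N m.+1) FQ) (functor_comp (shift_functor F N m) FA)
  (@NatTrans _ _ fibre_functor (functor_comp (shift_functor F N m.+1) FQ)
     (fun c => fibre_fst (qf c) m) a_nat)
  (@NatTrans _ _ fibre_functor (functor_comp (shift_functor F N m) FA)
     (fun c => fibre_snd (fc c) m) b_nat).
  by move=> c; apply: fibre_fst_quasi_iso (f_inj c) (qf c) (q_ker c) (q_surj c) m.
exists delta => c; have [deltaH deltaI] := deltaP c; split=> [d B0 B1|B].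
  by apply: deltaH; apply: fibre_snd_iso.
by apply: deltaI => d; apply: fibre_snd_iso.
Qed.

End ConnectingMorphism.

(** * Maps factoring through free modules *)

Section FreeFactor.
Variables (F : fieldType) (N : nat).
Implicit Types (K L M : vmod F N).

(** Freeness is only used through the fact that the identity of a finite rank free
    module is of this form ([free_factor_id]): along such a decomposition of the
    identity, additive natural statements pass from the modules [free1 a] to all free
    modules of finite rank. *)
Inductive free_factor L M : vhom L M -> Prop :=
| free_factor0 : free_factor 0
| free_factorD h a (p : vhom (free1 F a) M) (g : vhom L (free1 F a)) :
    free_factor h -> free_factor (h + vhom_comp p g).

Lemma free_factor_comp K L M P (u : vhom M P) (h : vhom L M) (v : vhom K L) :
  free_factor h -> free_factor (vhom_comp u (vhom_comp h v)).
Proof.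
elim=> [|h' a p g _ IH].
  have -> : vhom_comp u (vhom_comp (0 : vhom L M) v) = 0.
    by apply: vhom_ext => z x; rewrite /= linear0.
  exact: free_factor0.
have -> : vhom_comp u (vhom_comp (h' + vhom_comp p g) v) =
    vhom_comp u (vhom_comp h' v) + vhom_comp (vhom_comp u p) (vhom_comp g v).
  by apply: vhom_ext => z x; rewrite /= linearD.
exact: free_factorD.
Qed.

Lemma free_factor_free_sum s : free_factor (vhom_id (free_sum F s)).
Proof.
elim: s => [|a s IHs].
  have -> : vhom_id (free_sum F (Nil (grade N))) = 0 by apply: vhom_ext => z x; apply: indic0.
  exact: free_factor0.
have -> : vhom_id (free_sum F (a :: s)) =
    vhom_comp (dsum_inr _ _) (vhom_comp (vhom_id (free_sum F s)) (dsum_snd _ _)) +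
    vhom_comp (dsum_inl (free1 F a) (free_sum F s)) (dsum_fst _ _).
  apply: vhom_ext => z [x y]; rewrite [LHS]/=; congr pair; rewrite /=.
    by rewrite add0r.
  by rewrite addr0.
exact/free_factorD/free_factor_comp.
Qed.

Lemma free_factor_id M : free_finite_rank M -> free_factor (vhom_id M).
Proof.
move=> [s [f [g [gf _]]]].
have -> : vhom_id M = vhom_comp g (vhom_comp (vhom_id (free_sum F s)) f).
  have <- : vhom_comp g f = vhom_id M := gf.
  exact: vhom_ext.
exact/free_factor_comp/free_factor_free_sum.
Qed.

End FreeFactor.

(** * Indicator modules of convex sets of grades *)

Arguments indic_fun {F} b c.

Section Indicators.
Variables (F : fieldType) (N : nat).

Lemma indic_funC b c d (x : indic F b) :
  indic_fun c d (indic_fun b c x) = if c then indic_fun b d x else 0.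
Proof. by case: b c d x => [] [] [] x. Qed.

Lemma indic_fun_id b (x : indic F b) : indic_fun b b x = x.
Proof. by case: b x => x //=; rewrite [x]indic0. Qed.

Lemma indic_fun_square (p p' q q' : bool) (x : indic F p) :
    p = p' -> q = q' ->
  indic_fun q q' (indic_fun p q x) = indic_fun p' q' (indic_fun p p' x).
Proof. by move=> pp' <-; case: p' / pp'; rewrite !indic_fun_id. Qed.

Definition convex (P : grade N -> bool) : Prop :=
  forall v w u, v <=g w -> w <=g u -> P v -> P u -> P w.

Section Module.
Variables (P : grade N -> bool) (P_convex : convex P).

Definition indicator : vmod F N.
Proof.
refine (@VMod F N (fun v => indic F (P v)) (fun v w _ => indic_fun (P v) (P w)) _ _).
  by move=> v _ x /=; rewrite indic_fun_id.
move=> v w u vw wu vu x /=; rewrite indic_funC.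
case: ifPn => // Pw; have := P_convex vw wu.
case: (P v) x => x; last by rewrite [x]indic0 linear0.
by case: (P u) => // /(_ isT isT); rewrite (negPf Pw).
Defined.
End Module.

(** The condition [PQ] says exactly that the pointwise identities commute with the
    structure maps: it holds when [Q] is obtained from [P] by adding smaller grades or
    by deleting larger ones. *)
Definition indicator_hom P Q (P_convex : convex P) (Q_convex : convex Q)
  (PQ : forall v w, v <=g w -> P v -> Q w -> Q v = P w) :
  vhom (indicator P_convex) (indicator Q_convex).
Proof.
refine (@VHom F N (indicator P_convex) (indicator Q_convex)
  (fun v => indic_fun (P v) (Q v)) _).
move=> v w vw /= x; rewrite !indic_funC; have := PQ v w vw.
case: (P v) x => x; last by rewrite [x]indic0 !linear0 !if_same.
by case: (Q w) => [/(_ isT isT) ->|_] //=; rewrite !if_same.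
Defined.

End Indicators.

(** * Moving along axes *)

Section Grades.
Variable N : nat.
Implicit Types (z w u : grade N) (D : pred 'I_N).

Lemma grade_leD2r u z w : (z + u <=g w + u) = (z <=g w).
Proof. by apply: eq_forallb => i; rewrite !ffunE lerD2r. Qed.

Lemma grade_leD2l u z w : (u + z <=g u + w) = (z <=g w).
Proof. by rewrite ![u + _]addrC grade_leD2r. Qed.

(** Moves that only change, and only increase, the coordinates in [D].  With [pred1 k]
    these are the moves of the colimit along the axis [k]; with [pred0] there are only
    trivial ones, so that one lifting lemma covers lifting with and without moves. *)
Definition axis D z w : bool := [forall i, if D i then z i <= w i else z i == w i].

Lemma axisP D z w :
  axis D z w <-> (z <=g w) /\ (forall i, ~~ D i -> z i = w i).
Proof.
split=> [/forallP zw|[/forallP zw eq_zw]].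
  split=> [|i Di]; last by have := zw i; rewrite (negPf Di) => /eqP.
  by apply/forallP => i; have := zw i; case: (D i) => // /eqP->.
by apply/forallP => i; case: ifPn => [_|/eq_zw ->//]; apply: zw.
Qed.

Lemma axis_le D z w : axis D z w -> z <=g w.
Proof. by move=> /axisP []. Qed.

Lemma axis_refl D z : axis D z z.
Proof. by apply/axisP; split=> //; apply: grade_le_refl. Qed.

Lemma axis_trans D z w u : axis D z w -> axis D w u -> axis D z u.
Proof.
move=> /axisP [zw ezw] /axisP [wu ewu]; apply/axisP; split=> [|i Di].
  exact: grade_le_trans zw wu.
by rewrite ezw ?ewu.
Qed.

Definition raise (k : 'I_N) (c : int) z : grade N :=
  [ffun i => if i == k then Num.max (z i) c else z i].

Lemma axis_raise k c z : axis (pred1 k) z (raise k c z).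
Proof.
apply/forallP => i; rewrite !ffunE /=.
by case: (i == k); rewrite ?le_max ?lexx.
Qed.

Lemma raise_ge k c z : c <= raise k c z k.
Proof. by rewrite ffunE eqxx le_max lexx orbT. Qed.

End Grades.

(** * The global dual of a free module of rank one *)

Section Push.
Variables (F : fieldType) (N : nat).
Implicit Types (K L M X Y : vmod F N) (a z w : grade N).

(** Total in the two grades, so that it can be used in formulas in which [z <=g w] holds
    only where it matters. *)
Definition vpush M z w : {linear M z -> M w} :=
  match pselect (z <=g w) with left zw => vmap M zw | right _ => 0 end.

Lemma vpushE M z w (zw : z <=g w) : vpush M z w = vmap M zw.
Proof.
by rewrite /vpush; case: pselect => // zw'; rewrite (Prop_irrelevance zw' zw).
Qed.

Lemma vpush0 M z w : ~~ (z <=g w) -> vpush M z w = 0.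
Proof. by move=> /negP zw; rewrite /vpush; case: pselect. Qed.

Lemma vpush_natural L M (f : vhom L M) z w x :
  f w (vpush L z w x) = vpush M z w (f z x).
Proof.
case: (boolP (z <=g w)) => zw; first by rewrite !vpushE vnatural.
by rewrite !vpush0 //= linear0.
Qed.

(** Reading an element of an indicator space as a scalar makes it possible to write down
    the universal property of [free1] without transport along equalities of booleans. *)
Definition coef b (x : indic F b) : F := indic_fun b true x.

Lemma coef_span b (x : indic F b) : x = coef x *: indic1 F b.
Proof.
case: b x => x; last by rewrite [LHS]indic0 [RHS]indic0.
by rewrite /coef /= /GRing.scale /= mulr1.
Qed.

Lemma coef_indic1 (b : bool) : b -> coef (indic1 F b) = 1.
Proof. by case: b. Qed.

Lemma indic_recoord (p q r : bool) (x : indic F p) : p -> q -> r ->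
  x = coef (indic_fun p q x) *: indic_fun r p (indic1 F r).
Proof. by case: p q r x => [] [] [] // x _ _ _; apply: (coef_span (b := true)). Qed.

Section Yoneda.
Variables (M : vmod F N) (a : grade N) (x : M a).
Definition yoneda_fun w (y : free1 F a w) : M w := coef y *: vpush M a w x.
Fact yoneda_fun_linear w : linear (@yoneda_fun w).
Proof. by move=> c y y'; rewrite /yoneda_fun /coef linearP scalerDl scalerA. Qed.
HB.instance Definition _ w := GRing.isLinear.Build F (free1 F a w) (M w) *:%R
  (@yoneda_fun w) (@yoneda_fun_linear w).

Definition yoneda : vhom (free1 F a) M.
Proof.
refine (@VHom F N (free1 F a) M (fun w => @yoneda_fun w) _).
move=> z w zw /= y; rewrite /yoneda_fun linearZ /=.
have [az|/negP az] := pselect (a <=g z).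
  have aw := grade_le_trans az zw.
  rewrite !vpushE (vmap_comp _ _ aw) /coef; congr (_ *: _).
  by rewrite indic_funC aw.
suff -> : y = 0 by rewrite /coef !linear0 !scale0r.
by move: y; rewrite /= (negPf az); apply: indic0.
Defined.

Lemma yonedaE : yoneda a (indic1 F (a <=g a)) = x.
Proof.
have aa := grade_le_refl a.
by rewrite /= /yoneda_fun coef_indic1 // scale1r vpushE vmap_id.
Qed.
End Yoneda.

Lemma free1_hom_ext M a (f g : vhom (free1 F a) M) :
  f a (indic1 F (a <=g a)) = g a (indic1 F (a <=g a)) -> f = g.
Proof.
move=> fg; apply: vhom_ext => w y; rewrite [y]coef_span !linearZ; congr (_ *: _).
have [aw|/negP aw] := pselect (a <=g w).
  by rewrite -(vmap_indic1 F aw) !vnatural fg.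
suff -> : indic1 F (a <=g w) = 0 :> free1 F a w by rewrite !linear0.
by move: (indic1 _ _); rewrite /= (negPf aw); apply: indic0.
Qed.

(** The generator of the dual of [free1 a], which is free on it in grade [1 - a]. *)
Definition dual_gen a : gdual (free1 F a) (grade_one N - a) :=
  @yoneda (vshift (free1 F (grade_one N)) (grade_one N - a)) a
    (indic1 F (grade_one N <=g grade_one N - a + a)).

Section DualFree.
Variable a : grade N.
Let b := grade_one N - a.

Definition dual_coord_fun w (g : gdual (free1 F a) w) : free1 F b w :=
  indic_fun (grade_one N <=g w + a) (b <=g w) (g a (indic1 F (a <=g a))).
Fact dual_coord_fun_linear w : linear (@dual_coord_fun w).
Proof. by move=> c g h; rewrite /dual_coord_fun /= linearP. Qed.
HB.instance Definition _ w := GRing.isLinear.Build F (gdual (free1 F a) w) (free1 F b w) *:%R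
  (@dual_coord_fun w) (@dual_coord_fun_linear w).

Lemma dual_grade w : (grade_one N <=g w + a) = (b <=g w).
Proof. by rewrite -[grade_one N in LHS](subrK a) grade_leD2r. Qed.

Definition dual_coord : vhom (gdual (free1 F a)) (free1 F b).
Proof.
refine (@VHom F N (gdual (free1 F a)) (free1 F b) (fun w => @dual_coord_fun w) _).
by move=> z w zw g; apply: indic_fun_square; apply: dual_grade.
Defined.

Lemma dual_coord_gen : dual_coord b (dual_gen a) = indic1 F (b <=g b).
Proof.
rewrite /= /dual_coord_fun yonedaE; have := dual_grade b; have := grade_le_refl b.
by case: (b <=g b) => // _ ->.
Qed.

Lemma dual_gen_span w (g : gdual (free1 F a) w) :
  g = coef (dual_coord w g) *: vpush (gdual (free1 F a)) b w (dual_gen a).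
Proof.
apply: free1_hom_ext; rewrite /= /dual_coord_fun.
have [bw|/negP bw] := pselect (b <=g w).
  rewrite vpushE; apply: etrans (_ : _ = _ *: indic_fun (grade_one N <=g b + a)
    (grade_one N <=g w + a) (dual_gen a a (indic1 F (a <=g a)))) _ => //.
  by rewrite yonedaE; apply: indic_recoord; rewrite ?dual_grade ?grade_le_refl.
suff -> : g a (indic1 F (a <=g a)) = 0 by rewrite /coef !linear0 scale0r.
by move: (g a _); rewrite /= dual_grade (negPf bw); apply: indic0.
Qed.

Lemma dual_free1_ext X (f g : vhom (gdual (free1 F a)) X) :
  f b (dual_gen a) = g b (dual_gen a) -> f = g.
Proof.
move=> fg; apply: vhom_ext => w x.
by rewrite [x]dual_gen_span !linearZ !vpush_natural fg.
Qed.

Lemma dual_free1_ex X (x : X b) :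
  exists f : vhom (gdual (free1 F a)) X, f b (dual_gen a) = x.
Proof.
exists (vhom_comp (yoneda x) dual_coord).
rewrite [LHS]/= -[X in yoneda_fun _ X]/(dual_coord b (dual_gen a)) dual_coord_gen.
exact: yonedaE.
Qed.
End DualFree.
End Push.

(** * Tensoring free modules with a fixed module *)

Section Tensor.
Variables (F : fieldType) (N : nat).
Implicit Types (K L M X Y : vmod F N) (a z w : grade N).

Definition vshift_hom X Y (q : vhom X Y) z : vhom (vshift X z) (vshift Y z).
Proof.
refine (@VHom F N (vshift X z) (vshift Y z) (fun w => q (z + w)) _).
by move=> w u wu x; apply: (vnatural q).
Defined.

(** Pointwise lifts along a monomorphism are unique, hence natural and linear. *)
Lemma vpostcomp_lift K X Y (i : vhom X Y) (g : vhom K Y) :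
    (forall z, injective (i z)) -> (forall z x, exists y, i z y = g z x) ->
  exists g' : vhom K X, vhom_comp i g' = g.
Proof.
move=> i_inj gi; pose l z x := sval (cid (gi z x)).
have lK z x : i z (l z x) = g z x by rewrite /l; case: cid.
have l_linear z : linear (l z).
  by move=> a x y; apply: i_inj; rewrite linearP !lK linearP.
pose lL z := GRing.isLinear.Build _ _ _ _ _ (l_linear z).
pose l' z : {linear K z -> X z} := HB.pack (l z) (lL z).
have l_nat z w (zw : z <=g w) x : l' w (vmap K zw x) = vmap X zw (l' z x).
  by apply: i_inj; rewrite vnatural !lK vnatural.
by exists (VHom l_nat); apply: vhom_ext => z x; apply: lK.
Qed.

(** For free [M] this is the tensor product of [M] with [Y], up to the shift by
    [grade_one N]: [tensor Y (free1 a)] in grade [z] is [Y] in grade [z + (1 - a)].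
    It is exact in [Y], and specializes both to the identity and to [nakayama]. *)
Definition tensor Y M : vmod F N.
Proof.
refine (@VMod F N (fun z => vhom (gdual M) (vshift Y z) : lmodType F)
  (fun z w zw => @vpostcomp F N (gdual M) _ _ (vshift_map Y zw)) _ _).
  by move=> z zz f; apply: vhom_ext => v x; apply: (@vmap_id F N Y).
by move=> z w u zw wu zu f; apply: vhom_ext => v x; apply: (@vmap_comp F N Y).
Defined.

Definition tensor_map Y L M (h : vhom L M) : vhom (tensor Y L) (tensor Y M).
Proof.
refine (@VHom F N (tensor Y L) (tensor Y M) (fun z => @vprecomp F N _ _ _ (gdual_map h)) _).
by move=> z w zw g; apply: vhom_ext.
Defined.

Definition tensor_hom X Y (q : vhom X Y) M : vhom (tensor X M) (tensor Y M).
Proof.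
refine (@VHom F N (tensor X M) (tensor Y M)
  (fun z => @vpostcomp F N (gdual M) _ _ (vshift_hom q z)) _).
by move=> z w zw g; apply: vhom_ext => v x; apply: (vnatural q).
Defined.

Lemma tensor_mapE Y L M (h : vhom L M) z (f : tensor Y L z) w g :
  tensor_map Y h z f w g = f w (vhom_comp g h).
Proof. by []. Qed.

Lemma tensor_map_id Y M z f : tensor_map Y (vhom_id M) z f = f.
Proof. by apply: vhom_ext => w g; rewrite tensor_mapE; congr (f w _); apply: vhom_ext. Qed.

Lemma tensor_map_comp Y K L M (h : vhom L M) (k : vhom K L) z f :
  tensor_map Y (vhom_comp h k) z f = tensor_map Y h z (tensor_map Y k z f).
Proof.
by apply: vhom_ext => w g; rewrite !tensor_mapE; congr (f w _); apply: vhom_ext.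
Qed.

Lemma tensor_map0 Y L M z f : tensor_map Y (0 : vhom L M) z f = 0.
Proof.
apply: vhom_ext => w g; rewrite tensor_mapE -[RHS](linear0 (f w)); congr (f w _).
by apply: vhom_ext => v x; rewrite /= linear0.
Qed.

Lemma tensor_mapD Y L M (h k : vhom L M) z f :
  tensor_map Y (h + k) z f = tensor_map Y h z f + tensor_map Y k z f.
Proof.
apply: vhom_ext => w g; rewrite [RHS]/= -linearD; congr (f w _).
by apply: vhom_ext => v x; rewrite /= linearD.
Qed.

(** A morphism out of the dual of [free1 a] is determined by the image of the generator,
    so each summand of the identity of [M] contributes one space of [Y]. *)
Lemma tensor_fin_dim Y M :
  free_finite_rank M -> pointwise_fin_dim Y -> pointwise_fin_dim (tensor Y M).
Proof.
move=> /free_factor_id M_free Yfd z.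
suff H K (h : vhom M K) : free_factor h -> exists (E : lmodType F) (r : {linear tensor Y M z -> E}),
    fin_dim E /\ forall f, r f = 0 -> tensor_map Y h z f = 0.
  have [E [r [Efd rI]]] := H _ _ M_free.
  apply: (@fin_dim_inj _ _ _ r) => // f g rfg; apply/eqP; rewrite -subr_eq0; apply/eqP.
  by rewrite -[_ - _]tensor_map_id; apply: rI; rewrite linearB rfg subrr.
elim=> {h} [|h a p g _ [E [r [Efd rI]]]].
  exists (indic F false), 0; split=> [|f _]; last exact: tensor_map0.
  exact: fin_dim_indic.
pose ev (f : tensor Y (free1 F a) z) : Y (z + (grade_one N - a)) := f _ (dual_gen F a).
have ev_linear : linear ev by [].
pose evL := GRing.isLinear.Build _ _ _ _ _ ev_linear.
pose ev' : {linear tensor Y (free1 F a) z -> Y (z + (grade_one N - a))} := HB.pack ev evL.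
exists (E * Y (z + (grade_one N - a))%R)%type, (lin_pair r (lin_comp ev' (tensor_map Y g z))).
split=> [|f [/rI hf gf]]; first exact: fin_dim_pair.
rewrite tensor_mapD hf add0r tensor_map_comp.
suff -> : tensor_map Y g z f = 0 by rewrite linear0.
by apply: dual_free1_ext; apply: gf.
Qed.

Lemma tensor_hom_inj X Y (q : vhom X Y) M :
  (forall z, injective (q z)) -> forall z, injective (tensor_hom q M z).
Proof.
move=> q_inj z f g fg; apply: vhom_ext => w x; apply: q_inj.
exact: (congr1 (fun h : tensor Y M z => h w x) fg).
Qed.

Lemma tensor_hom_exact X Y X' (i : vhom X Y) (q : vhom Y X') M :
    (forall z, injective (i z)) ->
    (forall z y, q z y = 0 -> exists x, i z x = y) ->
  forall z f, tensor_hom q M z f = 0 -> exists g, tensor_hom i M z g = f.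
Proof.
move=> i_inj q_ker z f qf; apply: vpostcomp_lift => w; first exact: i_inj.
move=> x; apply: q_ker.
exact: (congr1 (fun h : tensor X' M z => h w x) qf).
Qed.

Lemma tensor_vmap_bij Y M z w (zw : z <=g w) :
  (forall u, bijective (vmap Y (grade_le_add u zw))) -> bijective (vmap (tensor Y M) zw).
Proof.
move=> Y_bij; apply: inj_surj_bijective => [f g fg|f].
  apply: vhom_ext => u x; apply: (bij_inj (Y_bij u)).
  exact: (congr1 (fun h : tensor Y M w => h u x) fg).
apply: (@vpostcomp_lift _ _ _ (vshift_map Y zw)) => u; first exact: (bij_inj (Y_bij u)).
by move=> x; have [v _ vK] := Y_bij u; exists (v (f u x)); exact: (vK (f u x)).
Qed.

(** Moving along the axes in [D] is what makes elements of [Y] lift to [X]; as the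
    dual of [M] is finitely generated, finitely many moves suffice for a morphism. *)
Lemma tensor_hom_lift (D : pred 'I_N) X Y (q : vhom X Y) M :
    (forall c z (y : Y (z + c)), exists w (zw : axis D z w) (x : X (w + c)),
       q (w + c) x = vmap Y (grade_le_add c (axis_le zw)) y) ->
    free_finite_rank M ->
  forall z (f : tensor Y M z), exists w (zw : axis D z w) (g : tensor X M w),
    tensor_hom q M w g = vmap (tensor Y M) (axis_le zw) f.
Proof.
move=> q_lift /free_factor_id M_free.
suff H (h : vhom M M) : free_factor h -> forall z (f : tensor Y M z),
    exists w (zw : axis D z w) (g : tensor X M w),
    tensor_hom q M w g = vmap (tensor Y M) (axis_le zw) (tensor_map Y h z f).
  move=> z f; have [w [zw [g gf]]] := H _ M_free z f.
  by exists w, zw, g; rewrite gf tensor_map_id.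
elim=> {h} [|h a p g _ IH] z f.
  by exists z, (axis_refl D z), 0; rewrite tensor_map0 !linear0.
have [w1 [zw1 [g1 fg1]]] := IH z f.
pose f1 := tensor_map Y g w1 (vmap (tensor Y M) (axis_le zw1) f).
have [w2 [w12 [x2 fx2]]] := q_lift _ w1 (f1 _ (dual_gen F a)).
have [g2 g2x] := @dual_free1_ex _ _ a (vshift X w2) x2.
exists w2, (axis_trans zw1 w12).
exists (vmap (tensor X M) (axis_le w12) g1 + tensor_map X p w2 g2).
have zw2 := axis_le (axis_trans zw1 w12).
rewrite linearD vnatural fg1 (vmap_comp _ _ zw2) tensor_mapD linearD.
rewrite (Prop_irrelevance zw2 (axis_le (axis_trans zw1 w12))); congr (_ + _).
rewrite tensor_map_comp.
have -> : tensor_hom q M w2 (tensor_map X p w2 g2) =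
    tensor_map Y p w2 (tensor_hom q (free1 F a) w2 g2) by apply: vhom_ext.
rewrite -vnatural; congr (tensor_map Y p w2 _).
apply: dual_free1_ext; rewrite [LHS]/= g2x fx2.
exact: (@vmap_comp F N Y).
Qed.

Lemma tensor_hom_surj X Y (q : vhom X Y) M :
    (forall z y, exists x, q z x = y) -> free_finite_rank M ->
  forall z f, exists g, tensor_hom q M z g = f.
Proof.
move=> q_surj M_free z f.
have [|w [zw [g gf]]] := @tensor_hom_lift pred0 _ _ q M _ M_free z f.
  move=> c v y; exists v, (axis_refl pred0 v); have [x xy] := q_surj _ y.
  by exists x; rewrite xy vmap_id.
have wz : z = w by apply/ffunP => i; have /axisP [_] := zw; apply.
by case: w / wz zw g gf => zw g gf; exists g; rewrite gf vmap_id.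
Qed.

End Tensor.

(** * Slabs and strips *)

Section Slabs.
Variables (F : fieldType) (N : nat).
Implicit Types (z w u v : grade N) (k : nat).

Definition slab_at k (i : 'I_N) (c : int) : bool := if (i < k)%N then c <= 0 else 1 <= c.

(** [slab 0] is the support of [free1 (grade_one N)] and [slab N] that of its Nakayama
    transform; [slab k] flips the condition on the first [k] coordinates. *)
Definition slab k u : bool := [forall i, slab_at k i (u i)].
(** [strip k] is the disjoint union of [slab k] and [slab k.+1].  In [strip k] the slab
    [slab k] is closed under increasing the grade, which gives an exact sequence
    [slab_mod k -> strip_mod k -> slab_mod k.+1]. *)
Definition strip k u : bool := [forall i : 'I_N, (i == k :> nat) || slab_at k i (u i)].

Lemma slab_at_convex k i (a b c : int) :
  a <= b -> b <= c -> slab_at k i a -> slab_at k i c -> slab_at k i b.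
Proof.
rewrite /slab_at; case: ifP => _ ab bc a0 c0; first exact: le_trans bc c0.
exact: le_trans a0 ab.
Qed.

Lemma slab_convex k : convex (slab k).
Proof.
move=> v w u /forallP vw /forallP wu /forallP sv /forallP su; apply/forallP => i.
exact: slab_at_convex (vw i) (wu i) (sv i) (su i).
Qed.

Lemma strip_convex k : convex (strip k).
Proof.
move=> v w u /forallP vw /forallP wu /forallP sv /forallP su; apply/forallP => i.
have := sv i; have := su i; case: (i == k :> nat) => //=.
by move=> /[swap]; apply: slab_at_convex.
Qed.

Lemma slab_strip (k : 'I_N) u : slab k u = strip k u && (1 <= u k).
Proof.
apply/forallP/andP => [su|[/forallP su uk] i].
  split; last by have := su k; rewrite /slab_at ltnn.
  by apply/forallP => i; rewrite su orbT.
have := su i; case: (i =P k :> nat) => [/val_inj ->|] //= _.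
by rewrite /slab_at ltnn.
Qed.

Lemma slabS_strip (k : 'I_N) u : slab k.+1 u = strip k u && ~~ (1 <= u k).
Proof.
have slabS_at (i : 'I_N) : i != k :> nat -> slab_at k.+1 i (u i) = slab_at k i (u i).
  by move=> ik; rewrite /slab_at ltnS leq_eqVlt (negPf ik).
have slabSk : slab_at k.+1 k (u k) = ~~ (1 <= u k).
  by rewrite /slab_at ltnS leqnn -ltNge -[X in _ < X]add0r ltzD1.
apply/forallP/andP => [su|[/forallP su uk] i].
  split; last by rewrite -slabSk.
  apply/forallP => i; case: eqP => //= /eqP ik; rewrite -slabS_at //; exact: su.
have [/val_inj->|/eqP ik] := i =P k :> nat; first by rewrite slabSk.
by have := su i; rewrite slabS_at // (negPf ik).
Qed.

Lemma strip_axis (k : 'I_N) v w c : axis (pred1 k) v w -> strip k (v + c) = strip k (w + c).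
Proof.
move=> /axisP [_ vw]; apply: eq_forallb => i.
by case: eqP => //= ik; rewrite !ffunE vw //=; apply/eqP => ik'; apply: ik; rewrite ik'.
Qed.

Lemma slab0 u : slab 0 u = (grade_one N <=g u).
Proof. by apply: eq_forallb => i; rewrite /slab_at ffunE. Qed.

Lemma slabN u : slab N u = (u <=g 0).
Proof. by apply: eq_forallb => i; rewrite /slab_at ltn_ord ffunE. Qed.

Definition slab_mod k : vmod F N := indicator F (@slab_convex k).
Definition strip_mod k : vmod F N := indicator F (@strip_convex k).

Fact slab_strip_compat (k : 'I_N) v w :
  v <=g w -> slab k v -> strip k w -> strip k v = slab k w.
Proof.
move=> /forallP vw; rewrite !slab_strip => /andP [-> vk] ->.
by rewrite (le_trans vk (vw k)).
Qed.

Fact strip_slabS_compat (k : 'I_N) v w :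
  v <=g w -> strip k v -> slab k.+1 w -> slab k.+1 v = strip k w.
Proof.
move=> /forallP vw; rewrite !slabS_strip => -> /andP [-> wk] /=.
by apply: contra wk => vk; apply: le_trans (vw k).
Qed.

Definition slab_to_strip (k : 'I_N) : vhom (slab_mod k) (strip_mod k) :=
  @indicator_hom F N _ _ (@slab_convex k) (@strip_convex k) (@slab_strip_compat k).
Definition strip_to_slabS (k : 'I_N) : vhom (strip_mod k) (slab_mod k.+1) :=
  @indicator_hom F N _ _ (@strip_convex k) (@slab_convex k.+1) (@strip_slabS_compat k).

Lemma slab_to_strip_inj (k : 'I_N) z : injective (slab_to_strip k z).
Proof.
move=> /= x y; have := slab_strip k z; case: (slab k z) x y => x y.
  by case: (strip k z).
by rewrite [x]indic0 [y]indic0.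
Qed.

Lemma strip_to_slabS_surj (k : 'I_N) z y : exists x, strip_to_slabS k z x = y.
Proof.
move: y => /=; have := slabS_strip k z; case: (slab k.+1 z) => [|_ y].
  by case: (strip k z) => // _ y; exists y.
by exists 0; rewrite linear0 [RHS]indic0.
Qed.

Lemma slab_strip_exact (k : 'I_N) z y :
  strip_to_slabS k z y = 0 <-> exists x, slab_to_strip k z x = y.
Proof.
move: y => /=; have := slabS_strip k z; have := slab_strip k z.
case: (strip k z) => /=; last by move=> -> -> y; split=> // _; exists 0; rewrite [RHS]indic0.
case: (1 <= z k) => -> -> y /=; first by split=> // _; exists y.
by split=> [->|[x <-] //]; exists 0.
Qed.

(** Increasing the coordinate [k] up to [1] moves the strip into the slab. *)
Lemma slab_to_strip_lift (k : 'I_N) c z (y : strip_mod k (z + c)) :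
  exists w (zw : axis (pred1 k) z w) (x : slab_mod k (w + c)),
    slab_to_strip k (w + c) x = vmap (strip_mod k) (grade_le_add c (axis_le zw)) y.
Proof.
exists (raise k (1 - c k) z), (axis_raise k (1 - c k) z) => /=.
have ck : 1 <= (raise k (1 - c k) z + c) k by rewrite ffunE -lerBlDr raise_ge.
have := slab_strip k (raise k (1 - c k) z + c); rewrite ck andbT.
move: (indic_fun _ _ y); case: (strip k (_ + c)) => y' ->; exists y'; apply: indic_fun_id.
Qed.

Lemma strip_vmap_bij (k : 'I_N) z w (zw : axis (pred1 k) z w) c :
  bijective (vmap (strip_mod k) (grade_le_add c (axis_le zw))).
Proof.
rewrite /=; have := strip_axis c zw; move: (strip k (w + c)) => b <-.
by exists idfun => x; rewrite /= indic_fun_id.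
Qed.

Lemma slab_mod_fin_dim k : pointwise_fin_dim (slab_mod k).
Proof. by move=> z; apply: fin_dim_indic. Qed.
Lemma strip_mod_fin_dim k : pointwise_fin_dim (strip_mod k).
Proof. by move=> z; apply: fin_dim_indic. Qed.

End Slabs.

(** * The two extreme slabs: bidual and Nakayama functor *)

Section Comparison.
Variables (F : fieldType) (N : nat).
Implicit Types (L M : vmod F N) (a z w : grade N).

Lemma indic_funK p q : p = q -> cancel (indic_fun p q) (@indic_fun F q p).
Proof. by move=> -> x; rewrite !indic_fun_id. Qed.

Lemma indic_fun_trans p q r (x : indic F p) :
  p = q -> indic_fun q r (indic_fun p q x) = indic_fun p r x.
Proof. by move=> <- {q}; rewrite indic_fun_id. Qed.

Lemma indic_eq (b : bool) (x y : indic F b) : (b -> x = y) -> x = y.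
Proof. by case: b x y => x y xy; [apply: xy | rewrite [x]indic0 [y]indic0]. Qed.

Lemma coef_indic_in (b : bool) (x : indic F b) : indic_fun true b (coef x) = x.
Proof. by case: b x => x; rewrite ?indic_fun_id // [LHS]indic0 [RHS]indic0. Qed.

Lemma slab0_addC z w : (grade_one N <=g w + z) = slab 0 (z + w).
Proof. by rewrite slab0 addrC. Qed.

Section BidualElement.
Variables (M : vmod F N) (z : grade N).

Definition bidual_eval (x : M z) w (g : gdual M w) : vshift (slab_mod F N 0) z w :=
  indic_fun (grade_one N <=g w + z) (slab 0 (z + w)) (g z x).
Fact bidual_eval_linear x w : linear (@bidual_eval x w).
Proof. by move=> c g h; rewrite /bidual_eval /= linearP. Qed.
HB.instance Definition _ x w := GRing.isLinear.Build F
  (gdual M w) (vshift (slab_mod F N 0) z w) *:%R (@bidual_eval x w) (@bidual_eval_linear x w).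

Definition bidual_fun (x : M z) : tensor (slab_mod F N 0) M z.
Proof.
refine (@VHom F N (gdual M) (vshift (slab_mod F N 0) z) (fun w => @bidual_eval x w) _).
by move=> w u wu g; apply: indic_fun_square; apply: slab0_addC.
Defined.

Fact bidual_fun_linear : linear bidual_fun.
Proof. by move=> c x y; apply: vhom_ext => w g; rewrite /= /bidual_eval !linearP. Qed.
HB.instance Definition _ := GRing.isLinear.Build F
  (M z) (tensor (slab_mod F N 0) M z) *:%R bidual_fun bidual_fun_linear.
End BidualElement.

(** Evaluation; up to replacing [free1 (grade_one N)] by [slab 0] this is the map of [M]
    to its global bidual. *)
Definition bidual M : vhom M (tensor (slab_mod F N 0) M).
Proof.
refine (@VHom F N M (tensor (slab_mod F N 0) M) (fun z => @bidual_fun M z) _).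
move=> z z' zz' x; apply: vhom_ext => w g; rewrite /= /bidual_eval vnatural.
by apply: indic_fun_square; apply: slab0_addC.
Defined.

Lemma bidual_natural L M (h : vhom L M) z x :
  bidual M z (h z x) = tensor_map (slab_mod F N 0) h z (bidual L z x).
Proof. exact: vhom_ext. Qed.

Lemma coef_indic_fun (p q r : bool) (y : indic F p) : p = q -> r ->
  coef y *: indic_fun r q (indic1 F r) = indic_fun p q y.
Proof.
by move=> <- {q}; case: p r y => [] [] // y _; rewrite ?indic_fun_id -?coef_span //
  [LHS]indic0 [RHS]indic0.
Qed.

Lemma dual_genE a z (y : free1 F a z) :
  dual_gen F a z y = indic_fun (a <=g z) (grade_one N <=g grade_one N - a + z) y.
Proof.
have az : (a <=g z) = (grade_one N <=g grade_one N - a + z).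
  by rewrite -(grade_leD2l (grade_one N - a)) subrK.
have [az'|/negP az'] := pselect (a <=g z).
  rewrite /= /yoneda_fun vpushE /=; apply: coef_indic_fun => //.
  by rewrite subrK grade_le_refl.
suff -> : y = 0 by rewrite !linear0.
by move: y; rewrite /= (negPf az'); apply: indic0.
Qed.

Lemma slab0_dual a z : (a <=g z) = slab 0 (z + (grade_one N - a)).
Proof. by rewrite slab0 addrC -(grade_leD2l (grade_one N - a)) subrK. Qed.

Lemma bidual_gen a z (y : free1 F a z) :
  bidual (free1 F a) z y _ (dual_gen F a) =
  indic_fun (a <=g z) (slab 0 (z + (grade_one N - a))) y.
Proof.
rewrite /= /bidual_eval dual_genE; apply: indic_fun_trans.
by rewrite slab0_addC; apply: slab0_dual.
Qed.

(** On [free1 a] both sides are determined by one scalar, by [bidual_gen]; naturality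
    carries this to [M] along the decomposition of its identity. *)
Lemma bidual_bij M : free_finite_rank M -> forall z, bijective (bidual M z).
Proof.
move=> /free_factor_id M_free z.
apply: inj_surj_bijective.
  suff H (h : vhom M M) x : free_factor h -> bidual M z x = 0 -> h z x = 0.
    move=> x y xy; apply/eqP; rewrite -subr_eq0; apply/eqP.
    by apply: (H _ _ M_free); rewrite linearB xy subrr.
  move=> h_ff x0; elim: h_ff => // h' a p g _ /= ->; rewrite add0r.
  suff -> : g z x = 0 by rewrite linear0.
  apply: (can_inj (indic_funK (slab0_dual a z))); rewrite -bidual_gen bidual_natural x0 !linear0.
  by [].
suff H (h : vhom M M) f : free_factor h -> exists x, bidual M z x = tensor_map _ h z f.
  by move=> f; have [x xf] := H _ f M_free; exists x; rewrite xf tensor_map_id.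
elim=> [|h' a p g _ [x xf]]; first by exists 0; rewrite linear0 tensor_map0.
pose f' := tensor_map _ g z f.
exists (x + p z (indic_fun _ (a <=g z) (f' _ (dual_gen F a)))).
rewrite linearD xf tensor_mapD bidual_natural tensor_map_comp; congr (_ + tensor_map _ _ _ _).
by apply: dual_free1_ext; rewrite bidual_gen; apply: (indic_funK (esym (slab0_dual a z))).
Qed.

Lemma slabN_le z w : slab N (z + w) = (w <=g - z).
Proof. by rewrite slabN -(grade_leD2r z w) addrC addNr. Qed.

Lemma vpush_vmap M z w u (wu : w <=g u) x : z <=g w ->
  vmap M wu (vpush M z w x) = vpush M z u x.
Proof.
move=> zw; have zu := grade_le_trans zw wu.
by rewrite !vpushE (vmap_comp _ _ zu).
Qed.

Lemma vmap_vpush M z w u (zw : z <=g w) x : w <=g u ->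
  vpush M w u (vmap M zw x) = vpush M z u x.
Proof.
move=> wu; have zu := grade_le_trans zw wu.
by rewrite !vpushE (vmap_comp _ _ zu).
Qed.

Section NakayamaElement.
Variables (M : vmod F N) (z : grade N).

Definition nakayama_eval (l : nakayama M z) w (g : gdual M w) : vshift (slab_mod F N N) z w :=
  indic_fun true (slab N (z + w)) (l (vpush (gdual M) w (- z) g)).
Fact nakayama_eval_linear l w : linear (@nakayama_eval l w).
Proof. by move=> c g h; rewrite /nakayama_eval !linearP. Qed.
HB.instance Definition _ l w := GRing.isLinear.Build F
  (gdual M w) (vshift (slab_mod F N N) z w) *:%R (@nakayama_eval l w) (@nakayama_eval_linear l w).

Definition nakayama_fun (l : nakayama M z) : tensor (slab_mod F N N) M z.
Proof.
refine (@VHom F N (gdual M) (vshift (slab_mod F N N) z) (fun w => @nakayama_eval l w) _).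
move=> w u wu g.
change (indic_fun true (slab N (z + u)) (l (vpush (gdual M) u (- z) (vmap (gdual M) wu g))) =
  indic_fun (slab N (z + w)) (slab N (z + u)) (nakayama_eval l g)).
apply: indic_eq => su.
have sw : slab N (z + w) by move: su; rewrite !slabN_le; apply: grade_le_trans.
by rewrite vmap_vpush -?slabN_le // /nakayama_eval indic_funC sw.
Defined.

Fact nakayama_fun_linear : linear nakayama_fun.
Proof. by move=> c x y; apply: vhom_ext => w g; rewrite /= /nakayama_eval !linearP. Qed.
HB.instance Definition _ := GRing.isLinear.Build F
  (nakayama M z) (tensor (slab_mod F N N) M z) *:%R nakayama_fun nakayama_fun_linear.
End NakayamaElement.

(** The universal property of the injective module supported on [w <= - z]: morphisms
    into it are functionals on the space in grade [- z], extended to the smaller grades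
    by first moving up to [- z]. *)
Definition nakayama_tensor M : vhom (nakayama M) (tensor (slab_mod F N N) M).
Proof.
refine (@VHom F N (nakayama M) (tensor (slab_mod F N N) M) (fun z => @nakayama_fun M z) _).
move=> z z' zz' l; apply: vhom_ext => w g.
change (indic_fun true (slab N (z' + w))
    (l (vmap (gdual M) (grade_le_opp zz') (vpush (gdual M) w (- z') g))) =
  indic_fun (slab N (z + w)) (slab N (z' + w)) (nakayama_eval l g)).
apply: indic_eq => su.
have wz' : w <=g - z' by rewrite -slabN_le.
have sw : slab N (z + w) by rewrite slabN_le (grade_le_trans wz') // grade_le_opp.
by rewrite vpush_vmap // /nakayama_eval indic_funC sw.
Defined.

Lemma nakayama_tensor_natural L M (h : vhom L M) z l :
  nakayama_tensor M z (nakayama_map h z l) =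
  tensor_map (slab_mod F N N) h z (nakayama_tensor L z l).
Proof.
apply: vhom_ext => w g; rewrite tensor_mapE /= /nakayama_eval /=.
by rewrite -(vpush_natural (gdual_map h)).
Qed.

Lemma nakayama_tensor_bij M z : bijective (nakayama_tensor M z).
Proof.
apply: inj_surj_bijective => [l l' ll'|f].
  apply: lin_ext => g.
  have := congr1 (fun h : tensor (slab_mod F N N) M z => h (- z) g) ll'.
  rewrite /= /nakayama_eval vpushE ?grade_le_refl // => zz; rewrite vmap_id.
  have : slab N (z - z) by rewrite slabN_le grade_le_refl.
  by case: (slab N (z - z)).
exists (lin_comp (@indic_fun F (slab N (z - z)) true) (f (- z))).
apply: vhom_ext => w g; rewrite /= /nakayama_eval /= vpush_natural.
have sz : slab N (z - z) by rewrite slabN_le grade_le_refl.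
apply: indic_eq => sw; have wz : w <=g - z by rewrite -slabN_le.
by rewrite vpushE /= !indic_funC sz; apply: coef_indic_in.
Qed.

End Comparison.

(** * Passing from one slab to the next *)

Section TensorComplexes.
Variables (F : fieldType) (N : nat).
Implicit Types (C : free_complex F N) (z w : grade N) (d : int).

Section Functor.
Variables (Y : vmod F N) (Yfd : pointwise_fin_dim Y).

Definition tensor_complex C : complex F N.
Proof.
refine (@Complex F N
  (fun i => PersMod (tensor_fin_dim (free_complex_free C i) Yfd))
  (fun i j ij => tensor_map Y (ch_diff C ij)) _).
by move=> i j k ij jk; apply: vhom_ext => z f; rewrite /= -tensor_map_comp ch_diff2 tensor_map0.
Defined.

Definition tensor_chain_map (C D : free_complex F N) (f : chain_map C D) :
  chain_map (tensor_complex C) (tensor_complex D).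
Proof.
refine (@ChainMap F N (tensor_complex C) (tensor_complex D)
  (fun i => tensor_map Y (f i)) _) => i j ij.
by apply: vhom_ext => z g; rewrite /= -!tensor_map_comp cm_comm.
Defined.

Definition tensor_functor : functor (free_cat F N) (chain_cat F N).
Proof.
refine (@Functor (free_cat F N) (chain_cat F N) tensor_complex tensor_chain_map _ _).
  by move=> C; apply: chain_map_ext => i z x; apply: tensor_map_id.
by move=> B C D g f; apply: chain_map_ext => i z x; apply: tensor_map_comp.
Defined.
End Functor.

Section FunctorHom.
Variables (X Y : vmod F N) (Xfd : pointwise_fin_dim X) (Yfd : pointwise_fin_dim Y).
Variable q : vhom X Y.

Definition tensor_chain_hom C : chain_map (tensor_complex Xfd C) (tensor_complex Yfd C).
Proof.
refine (@ChainMap F N (tensor_complex Xfd C) (tensor_complex Yfd C)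
  (fun i => tensor_hom q (C i)) _) => i j ij.
by apply: vhom_ext => z f; apply: vhom_ext.
Defined.

Definition tensor_functor_hom : nat_trans (tensor_functor Xfd) (tensor_functor Yfd).
Proof.
refine (@NatTrans _ _ (tensor_functor Xfd) (tensor_functor Yfd) tensor_chain_hom _).
by move=> C D f; apply: chain_map_ext => i z x; apply: vhom_ext.
Defined.
End FunctorHom.

Definition slab_complex k := tensor_functor (@slab_mod_fin_dim F N k).
Definition strip_complex k := tensor_functor (@strip_mod_fin_dim F N k).

(** The consequence of eventual vanishing on which the whole argument runs.  It speaks
    of one cycle and one axis at a time, so that a diagram chase carries it from
    [slab_complex k] to [slab_complex k.+1]. *)
Definition torsion_at (C : complex F N) d : Prop :=
  forall (k : 'I_N) z (x : C d z), is_cycle x ->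
  exists w (zw : axis (pred1 k) z w), is_boundary (vmap (C d) (axis_le zw) x).

(** Raising a single coordinate above the bound leaves the support. *)
Lemma eventually_vanishes_torsion (C : complex F N) d :
  eventually_vanishes (homology d C) -> torsion_at C d.
Proof.
move=> [b bP] k z x xc; exists (raise k (b k + 1) z), (axis_raise k (b k + 1) z).
set w := raise _ _ _; set y := vmap _ _ _.
apply: contrapT => yNb; suff /forallP/(_ k) : w <=g b.
  by rewrite leNgt => /negP; apply; rewrite -lezD1 raise_ge.
have yk : ker_pred (diff_out d C w) y by apply/eqP; exact: vmap_cycle.
apply: bP; exists (qpi _ (Cycle yk)) => y0; apply: yNb.
have /qpiP/asboolP : qpi (boundary_submod (diff_in d C w) _) (Cycle yk) = qpi _ 0.
  by rewrite linear0.
by move=> yb; apply/(is_boundaryP (erefl (d + 1))); rewrite -[y]subr0.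
Qed.

Lemma torsion_at_bij (C D : complex F N) (u : chain_map C D) d :
  (forall i z, bijective (u i z)) -> torsion_at C d -> torsion_at D d.
Proof.
move=> u_bij Ct k z y yc; have [v vK Kv] := u_bij d z.
have [|w [zw xb]] := Ct k z (v y).
  move=> j e; apply: (bij_inj (u_bij j z)).
  by rewrite cm_commE Kv yc linear0.
by exists w, zw; rewrite -[y]Kv -vnatural; apply: chain_map_boundary.
Qed.

Section Stage.
Variables (C : free_complex F N) (k : 'I_N).

Let A : complex F N := slab_complex k C.
Let B : complex F N := strip_complex k C.
Let Q : complex F N := slab_complex k.+1 C.
Let f : chain_map A B := tensor_functor_hom (@slab_mod_fin_dim F N k)
  (@strip_mod_fin_dim F N k) (slab_to_strip F k) C.
Let q : chain_map B Q := tensor_functor_hom (@strip_mod_fin_dim F N k)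
  (@slab_mod_fin_dim F N k.+1) (strip_to_slabS F k) C.

Lemma slab_to_strip_complex_inj i z : injective (f i z).
Proof. exact: tensor_hom_inj (slab_to_strip_inj (k := k)) z. Qed.

Lemma slab_to_strip_complex0 i z x : q i z (f i z x) = 0.
Proof.
apply: vhom_ext => w g; apply/(slab_strip_exact (k := k)); exists (x w g).
by [].
Qed.

Lemma slab_strip_complex_exact i z y : q i z y = 0 -> exists x, f i z x = y.
Proof.
apply: tensor_hom_exact; first exact: slab_to_strip_inj.
by move=> v x /slab_strip_exact.
Qed.

Lemma strip_to_slabS_complex_surj i z y : exists x, q i z x = y.
Proof.
apply: (tensor_hom_surj (q := strip_to_slabS F k)); last exact: free_complex_free.
exact: strip_to_slabS_surj.
Qed.

(** A cycle of the strip lifts to the slab after a move along the axis [k]; there it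
    is a cycle, hence a boundary after a further move.  Both moves are invertible in
    the strip. *)
Lemma strip_acyclic d : torsion_at A d -> acyclic_at B d.
Proof.
move=> At z x xc.
have [||w [zw [y yx]]] := @tensor_hom_lift F N (pred1 k) _ _ (slab_to_strip F k) (C d) _ _ z x.
- exact: slab_to_strip_lift.
- exact: free_complex_free.
have {}yx : f d w y = vmap (B d) (axis_le zw) x := yx.
have yc : @is_cycle F N A d w y.
  move=> j e; apply: slab_to_strip_complex_inj; rewrite linear0 cm_commE.
  by rewrite yx vnatural xc linear0.
have [u [wu yb]] := At k w y yc.
have zu := axis_trans zw wu.
have B_bij i : bijective (vmap (B i) (axis_le zu)).
  by apply: tensor_vmap_bij => c; apply: strip_vmap_bij.
have [i [e [b bx]]] : is_boundary (vmap (B d) (axis_le zu) x).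
  rewrite -(vmap_comp (axis_le zw) (axis_le wu)) -yx -vnatural.
  exact: (chain_map_boundary f).
have [v vK Kv] := B_bij i; exists i, e, (v b); apply: (bij_inj (B_bij d)).
by rewrite -vnatural Kv.
Qed.

(** A cycle of the quotient has a connecting cycle [a] in degree [d].  Once [a] bounds,
    the lift [b] can be corrected to a cycle of the strip, which bounds as well. *)
Lemma slabS_torsion d :
  torsion_at A d -> torsion_at A (d + 1) -> torsion_at Q (d + 1).
Proof.
move=> At At1 j z y yc; have [b qb] := strip_to_slabS_complex_surj y.
have [|a fa] := @slab_strip_complex_exact _ _ (ch_diff B erefl z b).
  by rewrite cm_commE qb yc.
have ac : is_cycle a.
  apply/(is_cycleP (pred_degree d)); apply: slab_to_strip_complex_inj.
  by rewrite linear0 cm_commE fa ch_diff2E.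
have [w [zw /(is_boundaryP (erefl (d + 1))) [a' a'a]]] := At j z a ac.
exists w, zw.
have : is_cycle (vmap (B (d + 1)) (axis_le zw) b - f (d + 1) w a').
  apply/(is_cycleP (erefl (d + 1))).
  by rewrite linearB vnatural -cm_commE a'a vnatural fa subrr.
move=> /(strip_acyclic At1) /(chain_map_boundary q).
by rewrite linearB slab_to_strip_complex0 subr0 vnatural qb.
Qed.

End Stage.
End TensorComplexes.

(** * The morphism from the Nakayama complex *)

Section NakayamaMorphism.
Variables (F : fieldType) (N : nat).
Implicit Types (C : free_complex F N) (d : int).

Definition bidual_chain C : chain_map C (slab_complex F N 0 C).
Proof.
refine (@ChainMap F N C (slab_complex F N 0 C) (fun i => bidual (C i)) _) => i j ij.
by apply: vhom_ext => z x; apply: bidual_natural.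
Defined.

Lemma bidual_chain_bij C i z : bijective (bidual_chain C i z).
Proof. exact/bidual_bij/free_complex_free. Qed.

Definition bidual_shift0 C : chain_map C (shift 0 (slab_complex F N 0 C)).
Proof.
refine (@ChainMap F N C (shift 0 (slab_complex F N 0 C))
  (fun i => cm_at (bidual_chain C) (esym (addr0 i))) _) => i j ij.
apply: vhom_ext => z x; apply/esym.
rewrite [LHS]/= expr0 scale1r.
exact: (cm_at_comm (bidual_chain C) _ ij).
Defined.

Lemma bidual_shift0_quasi_iso C :
  quasi_iso (bidual_shift0 C : @hom (chain_cat F N) C (shift 0 (slab_complex F N 0 C))).
Proof.
apply: bijective_quasi_iso => i z /=.
by case: _ / (esym (addr0 i)); apply: bidual_chain_bij.
Qed.

Definition bidual_shift0_nat :
  nat_trans (free_inclusion F N) (functor_comp (shift_functor F N 0) (slab_complex F N 0)).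
Proof.
refine (@NatTrans _ _ (free_inclusion F N)
  (functor_comp (shift_functor F N 0) (slab_complex F N 0)) bidual_shift0 _).
move=> C D f; apply: chain_map_ext => i z x /=; apply/esym.
apply: (cm_at_natural (b := tensor_chain_map (@slab_mod_fin_dim F N 0) f)) => k v y.
by apply: esym; apply: bidual_natural.
Defined.

Definition nakayama_shift C :
  chain_map (shift N (nakayama_complex C)) (shift N (slab_complex F N N C)).
Proof.
refine (@shift_map F N N (nakayama_complex C) (slab_complex F N N C)
  (@ChainMap F N (nakayama_complex C) (slab_complex F N N C)
     (fun i => nakayama_tensor (C i)) _)) => i j ij.
by apply: vhom_ext => z x; apply: nakayama_tensor_natural.
Defined.

Lemma nakayama_shift_quasi_iso C :
  quasi_iso (nakayama_shift C :
    @hom (chain_cat F N) (shift N (nakayama_complex C)) (shift N (slab_complex F N N C))).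
Proof. by apply: bijective_quasi_iso => i z; apply: nakayama_tensor_bij. Qed.

Definition nakayama_shift_nat :
  nat_trans (functor_comp (shift_functor F N N) (nakayama_functor F N))
            (functor_comp (shift_functor F N N) (slab_complex F N N)).
Proof.
refine (@NatTrans _ _ (functor_comp (shift_functor F N N) (nakayama_functor F N))
  (functor_comp (shift_functor F N N) (slab_complex F N N)) nakayama_shift _).
by move=> C D f; apply: chain_map_ext => i z x; apply: nakayama_tensor_natural.
Defined.

(** Each step raises the degree by one and uses two consecutive degrees of the step
    before, whence the window of [n + 1] degrees. *)
Lemma slab_torsion n C : (n <= N)%N -> forall d,
  (forall k : nat, (k <= n)%N -> torsion_at C (d + k%:Z)) ->
  torsion_at (slab_complex F N n C) (d + n%:Z).
Proof.
elim: n => [|n IH] nN d Ct.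
  by apply: (torsion_at_bij (u := bidual_chain C)); [apply: bidual_chain_bij | apply: Ct].
have E : d + n.+1%:Z = d + n%:Z + 1 by rewrite -addn1 PoszD addrA.
rewrite E; apply: (@slabS_torsion F N C (Ordinal nN)) => /=.
  by apply: IH => [|k kn]; [apply: ltnW | apply: Ct; apply: leqW].
rewrite addrAC; apply: IH => [|k kn]; first exact: ltnW.
by rewrite -addrA -PoszD add1n; apply: Ct.
Qed.

(** The composite of [n] connecting morphisms, of which the one from [slab_complex k.+1]
    to [slab_complex k] is taken in the shift by [k]; it ends with the inverse of
    evaluation in the bidual. *)
Lemma slab_connecting n : (n <= N)%N ->
  exists phi : nat_trans
      (functor_comp (to_derived F N) (functor_comp (shift_functor F N n) (slab_complex F N n)))
      (functor_comp (to_derived F N) (free_inclusion F N)),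
    forall C,
      (forall d, (forall k : nat, (k <= n)%N -> torsion_at C (d + k%:Z)) ->
         is_iso (fmap (derived_homology F N d) (phi C))) /\
      ((forall d, torsion_at C d) -> is_iso (phi C)).
Proof.
elim: n => [_|n IH nN].
  have [|phi phiP] := @derived_roof F N _ _ _ _ bidual_shift0_nat
    (nat_trans_id (free_inclusion F N)).
    exact: bidual_shift0_quasi_iso.
  exists phi => C; have [phiH phiI] := phiP C; split=> [d _|_].
    by apply: phiH; rewrite fmap1; apply: is_iso_id.
  by apply: phiI => d; rewrite fmap1; apply: is_iso_id.
have [phi phiP] := IH (ltnW nN); pose k := Ordinal nN.
have [||||delta deltaP] := @connecting_morphism F N _ _ _ _
  (tensor_functor_hom (@slab_mod_fin_dim F N k) (@strip_mod_fin_dim F N k) (slab_to_strip F k))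
  (tensor_functor_hom (@strip_mod_fin_dim F N k) (@slab_mod_fin_dim F N k.+1)
     (strip_to_slabS F k)) n.
- by move=> C i z; apply: slab_to_strip_complex_inj.
- by move=> C i z x; apply: slab_to_strip_complex0.
- by move=> C i z y; apply: slab_strip_complex_exact.
- by move=> C i z y; apply: strip_to_slabS_complex_surj.
exists (nat_trans_comp phi delta) => C.
have [phiH phiI] := phiP C; have [deltaH deltaI] := deltaP C.
split=> [d Ct|Ct].
  have E : d + n.+1%:Z = d + 1 + n%:Z by rewrite -add1n PoszD addrA.
  rewrite [nat_trans_comp phi delta C]/= fmapM; apply: is_iso_comp.
    by apply: phiH => j jn; apply: Ct; apply: leqW.
  apply: deltaH; apply: (@strip_acyclic F N C k).
    by apply: slab_torsion => [|j jn]; [apply: ltnW | apply: Ct; apply: leqW].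
  rewrite E; apply: slab_torsion => [|j jn]; first exact: ltnW.
  by rewrite -addrA -PoszD add1n; apply: Ct.
apply: is_iso_comp; first exact: phiI.
apply: deltaI => d; apply: (@strip_acyclic F N C k).
rewrite -[d](subrK n%:Z); apply: slab_torsion => [|j _]; [exact: ltnW | exact: Ct].
Qed.

End NakayamaMorphism.

Theorem theorem3p8 (F : fieldType) (N : nat) :
  exists phi : nat_trans
      (functor_comp (to_derived F N)
        (functor_comp (shift_functor F N N) (nakayama_functor F N)))
      (functor_comp (to_derived F N) (free_inclusion F N)),
    forall C : free_complex F N,
      (forall d : int,
        (forall k : nat, (k <= N)%N ->
          eventually_vanishes (homology (d + k%:Z) C)) ->
        is_iso (fmap (derived_homology F N d) (phi C))) /\
      (eventually_acyclic C -> is_iso (phi C)).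
Proof.
have [phi phiP] := @slab_connecting F N N (leqnn N).
have [|theta thetaP] := @derived_roof F N _ _ _ _ (nat_trans_id _) (nakayama_shift_nat F N).
  by move=> C d; rewrite fmap1; apply: is_iso_id.
exists (nat_trans_comp phi theta) => C.
have [phiH phiI] := phiP C; have [thetaH thetaI] := thetaP C.
split=> [d Cv|Cv].
  rewrite [nat_trans_comp phi theta C]/= fmapM; apply: is_iso_comp.
    by apply: phiH => k kN; apply/eventually_vanishes_torsion/Cv.
  by apply: thetaH; apply: nakayama_shift_quasi_iso.
apply: is_iso_comp.
  by apply: phiI => d; apply: eventually_vanishes_torsion.
exact/thetaI/nakayama_shift_quasi_iso.
Qed.
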